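(* Let $R$ be a preradical in $\overline{\mathbf{L}}$. (i) If $R$ is an under radical then $R^{\ast}$ is the smallest radical larger than or equal to $R$. (ii) If $R$ is an over radical then $R^{\circ}$ is the largest radical smaller than or equal to $R$.
   Context: A Banach Lie algebra is a complex Lie algebra $\mathcal{L}$ which is a Banach space in a norm such that, for some $t_{\mathcal{L}}>0$, $\|[a,b]\|\leq t_{\mathcal{L}}\|a\|\|b\|$ for all $a,b\in\mathcal{L}$. $\overline{\mathbf{L}}$ is the category of all Banach Lie algebras with bounded Lie homomorphisms with dense image as morphisms. A preradical in $\overline{\mathbf{L}}$ is a map $R$ sending each Banach Lie algebra $\mathcal{L}$ to a closed Lie ideal $R(\mathcal{L})$ of $\mathcal{L}$ such that $f(R(\mathcal{L}))\subseteq R(\mathcal{M})$ for each morphism $f:\mathcal{L}\to\mathcal{M}$. It is lower stable if $R(R(\mathcal{L}))=R(\mathcal{L})$ for all $\mathcal{L}$; upper stable if $R(\mathcal{L}/R(\mathcal{L}))=\{0\}$ for all $\mathcal{L}$; balanced if $R(I)\subseteq R(\mathcal{L})$ for each closed Lie ideal $I$ of each $\mathcal{L}$. An under radical is a lower stable balanced preradical; an over radical is an upper stable balanced preradical; a radical is a lower stable, upper stable, balanced preradical. For preradicals, $T\leq R$ means $T(\mathcal{L})\subseteq R(\mathcal{L})$ for all $\mathcal{L}$. $R^{\circ}$: put $R^{0}(\mathcal{L})=\mathcal{L}$, $R^{\alpha+1}(\mathcal{L})=R(R^{\alpha}(\mathcal{L}))$, $R^{\alpha}(\mathcal{L})=\bigcap_{\alpha'<\alpha}R^{\alpha'}(\mathcal{L})$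 for limit ordinals $\alpha$; $R^{\circ}(\mathcal{L})$ is the value at which this decreasing transfinite chain stabilizes. $R^{\ast}$: put $R^{(0)}(\mathcal{L})=\{0\}$, $R^{(\alpha+1)}(\mathcal{L})=q_{\alpha}^{-1}\bigl(R(\mathcal{L}/R^{(\alpha)}(\mathcal{L}))\bigr)$ where $q_{\alpha}:\mathcal{L}\to\mathcal{L}/R^{(\alpha)}(\mathcal{L})$ is the quotient map, and $R^{(\alpha)}(\mathcal{L})=\overline{\bigcup_{\alpha'<\alpha}R^{(\alpha')}(\mathcal{L})}$ for limit ordinals $\alpha$; $R^{\ast}(\mathcal{L})$ is the value at which this increasing transfinite chain of closed Lie ideals stabilizes. *)

(* Defs.v *)
From HB Require Import structures.
From mathcomp Require Import all_boot all_order all_algebra.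
From mathcomp Require Import generic_quotient ring_quotient complex.
From mathcomp Require Import mathcomp_extra boolp classical_sets wochoice.
From mathcomp Require Import reals topology normedtype ring interval_inference.

Set Implicit Arguments.
Unset Strict Implicit.
Unset Printing Implicit Defensive.

Import Order.TTheory GRing.Theory Num.Theory.
Import numFieldNormedType.Exports.

Local Open Scope classical_set_scope.
Local Open Scope ring_scope.
Local Open Scope complex_scope.
Local Open Scope quotient_scope.

Section ComplexAux.
Context {R : realType}.

Lemma ReK (x : R[i]) : 0 <= x -> (complex.Re x)%:C = x.
Proof. by move=> x0; rewrite RRe_real// ger0_real. Qed.

Lemma le0Re (x : R[i]) : 0 <= x -> 0 <= complex.Re x.
Proof. by move=> x0; rewrite -ler0c ReK. Qed.

Lemma small_expn (e : R[i]) : 0 < e ->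
  exists n, (2^-1 : R[i]) ^+ n < e.
Proof.
move=> e0; have e0' : 0 < complex.Re e by rewrite -ltcR ReK// ltW.
have [n _ /(_ n (leqnn n))] := near_infty_natSinv_expn_lt (PosNum e0').
rewrite /= -ltcR ReK ?ltW// => ne; exists n; move: ne.
by rewrite rmorphM/= rmorph1 fmorphV rmorphXn/= rmorphMn/= rmorph1 mul1r exprVn.
Qed.

End ComplexAux.

HB.mixin Record CompleteNormedModule_isBanachLie (R : realType) L
    & CompleteNormedModule R[i] L := {
  lie : L -> L -> L;
  lie_linearl : forall y, linear (lie^~ y);
  lie_linearr : forall x, linear (lie x);
  liexx : forall x, lie x x = 0;
  lie_jacobi : forall x y z,
    lie x (lie y z) + lie y (lie z x) + lie z (lie x y) = 0;
  lie_bounded : exists2 t : R[i], 0 < t &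
    forall x y, `|lie x y| <= t * `|x| * `|y|
}.

#[short(type="banachLieType")]
HB.structure Definition BanachLie (R : realType) :=
  {L of CompleteNormedModule R[i] L & CompleteNormedModule_isBanachLie R L}.

Definition closed_subalgebra (R : realType) (L : banachLieType R)
    (S : set L) : Prop :=
  [/\ S 0, forall (c : R[i]) x y, S x -> S y -> S (c *: x + y),
      forall x y, S x -> S y -> S (lie x y) & closed S].

(* Left multiplication suffices, since the bracket is alternating. *)
Definition closed_ideal (R : realType) (L : banachLieType R)
    (I : set L) : Prop :=
  [/\ I 0, forall (c : R[i]) x y, I x -> I y -> I (c *: x + y),
      forall x y, I y -> I (lie x y) & closed I].

Section LieTheory.
Context {R : realType} {L : banachLieType R}.

Lemma lieBl (x y z : L) : lie (x - y) z = lie x z - lie y z.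
Proof.
have /= := lie_linearl z (-1) y x; rewrite !scaleN1r => h.
by rewrite addrC h addrC.
Qed.

Lemma lieBr (x y z : L) : lie z (x - y) = lie z x - lie z y.
Proof.
have /= := lie_linearr z (-1) y x; rewrite !scaleN1r => h.
by rewrite addrC h addrC.
Qed.

Lemma lieC (x y : L) : lie x y = - lie y x.
Proof.
have lieN (u v : L) : lie u (- v) = - lie u v.
  by have := lieBr 0 v u; rewrite !sub0r => ->; rewrite -[in lie u 0](subrr u) lieBr subrr sub0r.
have := liexx (x - y); rewrite lieBl !lieBr !liexx subr0 sub0r => /eqP.
by rewrite subr_eq0 => /eqP h; rewrite -[LHS]opprK h.
Qed.

End LieTheory.

Section SubLie.
Context {R : realType} {L : banachLieType R} {S : set L}.

Definition sub_pred of closed_subalgebra S : pred L := fun x => x \in S.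

Variable hS : closed_subalgebra S.

Lemma sub_pred_submod : GRing.submod_closed (sub_pred hS).
Proof.
have [S0 Sl _ _] := hS; split; first by rewrite unfold_in /sub_pred inE.
by move=> c x y; rewrite !unfold_in /sub_pred !inE; exact: Sl.
Qed.

HB.instance Definition _ :=
  GRing.isSubmodClosed.Build R[i] L (sub_pred hS) sub_pred_submod.

Definition subLie : Type := {x : L | sub_pred hS x}.
HB.instance Definition _ := SubChoice.on subLie.
HB.instance Definition _ := [SubChoice_isSubLmodule of subLie by <:].

Definition sub_norm (x : subLie) : R[i] := `|val x|.

Lemma sub_normD x y : sub_norm (x + y) <= sub_norm x + sub_norm y.
Proof. exact: ler_normD. Qed.

Lemma sub_normZ (c : R[i]) x : sub_norm (c *: x) = `|c| * sub_norm x.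
Proof. exact: normrZ. Qed.

Lemma sub_norm0_eq0 x : sub_norm x = 0 -> x = 0.
Proof. by move=> /normr0_eq0 x0; apply: val_inj. Qed.

HB.instance Definition _ := Lmodule_isNormed.Build R[i] subLie
  sub_normD sub_normZ sub_norm0_eq0.

Lemma sub_ballE (x : subLie) (e : R[i]) y : ball x e y = ball (val x) e (val y).
Proof. by rewrite -!ball_normE /=. Qed.

Lemma subLieP (x : subLie) : S (val x).
Proof. by have := valP x; rewrite /sub_pred inE. Qed.

Lemma sub_complete (F : set_system subLie) :
  ProperFilter F -> cauchy F -> cvg F.
Proof.
move=> FF cF; pose G : set_system L := val @ F.
have GG : ProperFilter G by exact: fmap_proper_filter.
have cG : cauchy G.
  apply/cauchy_ballP => e e0; move/cauchy_ballP : cF => /(_ e e0).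
  rewrite /prop_near1 /= => -[[A B] /= [FA FB] AB].
  exists (val @` A, val @` B) => /=.
    split; rewrite /G /= /nbhs /=.
      by apply: filterS FA => z Az; exists z.
    by apply: filterS FB => z Bz; exists z.
  move=> [_ _] /= [[a Aa <-] [b Bb <-]].
  by rewrite -sub_ballE; exact: (AB (a, b)).
have [l Gl] : exists l : L, G --> l.
  by apply/cvg_ex; exact: cauchy_cvg.
have Sl : S l.
  have [_ _ _ /closure_id ->] := hS => B Bl.
  have FB : F [set z | B (val z)] by exact: Gl Bl.
  have [z Bz] := filter_ex FB.
  by exists (val z); split => //; exact: subLieP.
have Sl' : sub_pred hS l by rewrite /sub_pred inE.
apply/cvg_ex; exists (Sub l Sl') => A /nbhs_ballP[e /= e0 eA].
have Fe : F [set z | ball l e (val z)].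
  by have : nbhs l (ball l e) by [exact: nbhsx_ballx]; exact: Gl.
by apply: filterS Fe => z lz; apply: eA; rewrite sub_ballE SubK.
Qed.

HB.instance Definition _ := Uniform_isComplete.Build subLie sub_complete.

Lemma sub_lie_subproof (x y : subLie) : sub_pred hS (lie (val x) (val y)).
Proof.
by have [_ _ h _] := hS; rewrite /sub_pred inE; apply: h; exact: subLieP.
Qed.

Definition sub_lie (x y : subLie) : subLie :=
  Sub (lie (val x) (val y)) (sub_lie_subproof x y).

Lemma sub_lie_linearl y : linear (sub_lie^~ y).
Proof. by move=> c x z; apply: val_inj; exact: lie_linearl. Qed.

Lemma sub_lie_linearr x : linear (sub_lie x).
Proof. by move=> c y z; apply: val_inj; exact: lie_linearr. Qed.

Lemma sub_liexx x : sub_lie x x = 0.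
Proof. by apply: val_inj; exact: liexx. Qed.

Lemma sub_lie_jacobi x y z : sub_lie x (sub_lie y z) +
  sub_lie y (sub_lie z x) + sub_lie z (sub_lie x y) = 0.
Proof. by apply: val_inj; exact: lie_jacobi. Qed.

Lemma sub_lie_bounded : exists2 t : R[i], 0 < t &
  forall x y, `|sub_lie x y| <= t * `|x| * `|y|.
Proof.
by have [t t0 ht] := @lie_bounded R L; exists t => // x y; exact: ht.
Qed.

HB.instance Definition _ := CompleteNormedModule_isBanachLie.Build R subLie
  sub_lie_linearl sub_lie_linearr sub_liexx sub_lie_jacobi sub_lie_bounded.

End SubLie.

Section QuotLie.
Context {R : realType} {L : banachLieType R} {I : set L}.

Definition ideal_pred of closed_ideal I : L -> bool := fun x => x \in I.

Variable hI : closed_ideal I.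

Lemma ideal_pred_zmod : zmod_closed (ideal_pred hI).
Proof.
have [I0 Il _ _] := hI; split; first by rewrite unfold_in /ideal_pred inE.
move=> x y; rewrite !unfold_in /ideal_pred !inE => Ix Iy.
by rewrite addrC -scaleN1r; exact: Il.
Qed.

HB.instance Definition _ :=
  GRing.isZmodClosed.Build L (ideal_pred hI) ideal_pred_zmod.

Definition ideal_zmod : zmodClosed L := GRing.ZmodClosed.clone L (ideal_pred hI) _.
Definition quotLie : Type := @Quotient.quot L ideal_zmod.
HB.instance Definition _ := GRing.Zmodule.on quotLie.

Definition quot_proj (x : L) : quotLie := \pi_(@Quotient.quot L ideal_zmod) x.
Definition quot_repr (q : quotLie) : L := repr (q : @Quotient.quot L ideal_zmod).

Lemma quot_reprK q : quot_proj (quot_repr q) = q.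
Proof. exact: reprK. Qed.

Lemma quot_projP x y : quot_proj x = quot_proj y <-> I (x - y).
Proof.
split=> [/eqP|Ixy].
  by rewrite -[_ == _]Quotient.idealrBE /in_mem /= /ideal_pred inE.
apply/eqP; rewrite -[_ == _]Quotient.idealrBE /in_mem /= /ideal_pred.
by rewrite inE.
Qed.

Lemma quot_projD x y : quot_proj (x + y) = quot_proj x + quot_proj y.
Proof. exact: Quotient.pi_add. Qed.

Lemma quot_projB x y : quot_proj (x - y) = quot_proj x - quot_proj y.
Proof.
by rewrite quot_projD; congr (_ + _); exact: Quotient.pi_opp.
Qed.

Lemma quot_repr_proj x : I (quot_repr (quot_proj x) - x).
Proof. by apply/quot_projP; rewrite quot_reprK. Qed.

Definition quot_scale (c : R[i]) (q : quotLie) : quotLie :=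
  quot_proj (c *: quot_repr q).

Lemma quot_projZ c x : quot_proj (c *: x) = quot_scale c (quot_proj x).
Proof.
apply/esym/quot_projP; rewrite -scalerBr -[_ *: _]addr0.
by have [I0 Il _ _] := hI; apply: Il => //; exact: quot_repr_proj.
Qed.

Lemma quot_scaleA a b q : quot_scale a (quot_scale b q) = quot_scale (a * b) q.
Proof. by rewrite {2}/quot_scale -quot_projZ scalerA. Qed.

Lemma quot_scale1 : left_id 1 quot_scale.
Proof. by move=> q; rewrite /quot_scale scale1r quot_reprK. Qed.

Lemma quot_scaleDr : right_distributive quot_scale +%R.
Proof.
move=> c p q; rewrite -(quot_reprK p) -(quot_reprK q) -quot_projD -!quot_projZ.
by rewrite -quot_projD scalerDr.
Qed.

Lemma quot_scaleDl q : {morph quot_scale^~ q : a b / a + b}.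
Proof.
by move=> a b; rewrite -(quot_reprK q) -!quot_projZ -quot_projD scalerDl.
Qed.

HB.instance Definition _ := GRing.Zmodule_isLmodule.Build R[i] quotLie
  quot_scaleA quot_scale1 quot_scaleDr quot_scaleDl.

Lemma quot_proj_linear : linear quot_proj.
Proof. by move=> c x y; rewrite quot_projD quot_projZ. Qed.

Lemma quot_ind (P : quotLie -> Prop) : (forall x, P (quot_proj x)) -> forall q, P q.
Proof. by move=> h q; rewrite -(quot_reprK q). Qed.

Definition quot_norm (q : quotLie) : R[i] :=
  (inf [set complex.Re `|x| | x in [set x | quot_proj x = q]])%:C.

Lemma has_inf_quot q :
  has_inf [set complex.Re `|x| | x in [set x | quot_proj x = q]].
Proof.
split; first by exists (complex.Re `|quot_repr q|), (quot_repr q) => //; exact: quot_reprK.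
by exists 0 => _ [x _ <-]; exact: le0Re.
Qed.

Lemma quot_norm_le x : quot_norm (quot_proj x) <= `|x|.
Proof.
rewrite -[leRHS]ReK// lecR; apply: ge_inf; last by exists x.
by have [] := has_inf_quot (quot_proj x).
Qed.

Lemma quot_norm_lt q (e : R[i]) : 0 < e ->
  exists2 x, quot_proj x = q & `|x| < quot_norm q + e.
Proof.
move=> e0; have e0' : 0 < complex.Re e by rewrite -ltcR ReK// ltW.
have [_ [x xq <-] xe] := inf_adherent e0' (has_inf_quot q).
exists x => //; rewrite -ltcR ReK// in xe; apply: (lt_le_trans xe).
by rewrite rmorphD/= ReK// ltW.
Qed.

Lemma quot_norm_ge0 q : 0 <= quot_norm q.
Proof.
rewrite ler0c; apply: lb_le_inf; first by have [] := has_inf_quot q.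
by move=> _ [x _ <-]; exact: le0Re.
Qed.

Lemma quot_norm_ler q (a : R[i]) : 
  (forall e, 0 < e -> exists2 x, quot_proj x = q & `|x| <= a + e) ->
  quot_norm q <= a.
Proof.
move=> h; apply/ler_addgt0Pr => e /h[x <- xa].
exact: le_trans (quot_norm_le x) xa.
Qed.

Lemma quot_normD p q : quot_norm (p + q) <= quot_norm p + quot_norm q.
Proof.
apply: quot_norm_ler => e e0; have e20 : 0 < e / 2 by rewrite divr_gt0.
have [x xp xe] := quot_norm_lt p e20; have [y yq ye] := quot_norm_lt q e20.
exists (x + y); first by rewrite quot_projD xp yq.
rewrite (le_trans (ler_normD _ _))// (le_trans (lerD (ltW xe) (ltW ye)))//.
by rewrite addrACA -splitr.
Qed.

Lemma quot_normZ_le (c : R[i]) q : quot_norm (c *: q) <= `|c| * quot_norm q.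
Proof.
have [->|c0] := eqVneq c 0.
  rewrite scale0r normr0 mul0r.
  have <- : quot_proj 0 = 0 by rewrite -(subrr 0) quot_projB subrr.
  by rewrite (le_trans (quot_norm_le _))// normr0.
apply: quot_norm_ler => e e0.
have [|x xq xe] := @quot_norm_lt q (e / `|c|); first by rewrite divr_gt0// normr_gt0.
exists (c *: x); first by rewrite quot_projZ xq.
rewrite normrZ (le_trans (ler_wpM2l _ (ltW xe)))// mulrDr mulrCA divff ?mulr1//.
by rewrite normr_eq0.
Qed.

Lemma quot_normZ (c : R[i]) q : quot_norm (c *: q) = `|c| * quot_norm q.
Proof.
apply/eqP; rewrite eq_le quot_normZ_le/=.
have [->|c0] := eqVneq c 0; first by rewrite normr0 mul0r quot_norm_ge0.
rewrite -[in leLHS](scalerK c0 q) -ler_pdivlMl ?normr_gt0// -normfV.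
exact: quot_normZ_le.
Qed.

Lemma quot_norm0_eq0 q : quot_norm q = 0 -> q = 0.
Proof.
elim/quot_ind: q => x x0.
have <- : quot_proj 0 = 0 by rewrite -(subrr 0) quot_projB subrr.
apply/quot_projP; rewrite subr0; have [_ _ _ /closure_id ->] := hI.
move=> B /nbhs_ballP[e /= e0 eB].
have [y yx] := quot_norm_lt (quot_proj x) e0; rewrite x0 add0r => ye.
exists (x - y); split; first by apply/quot_projP.
by apply: eB; rewrite -ball_normE /= opprB addrC subrK.
Qed.

HB.instance Definition _ := Lmodule_isNormed.Build R[i] quotLie
  quot_normD quot_normZ quot_norm0_eq0.

Lemma quot_complete (F : set_system quotLie) :
  ProperFilter F -> cauchy F -> cvg F.
Proof.
move=> FF cF; pose r n : R[i] := 2^-1 ^+ n.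
have r0 n : 0 < r n by rewrite exprn_gt0// invr_gt0.
have rS n : r n = r n.+1 + r n.+1.
  by rewrite /r exprS -mulrDl -[X in (X + X) * _]div1r -splitr mul1r.
have /choice[q qF] : forall n, exists q, F (ball q (r n)).
  by move=> n; move/cauchyP : cF => /(_ _ (r0 n)).
have qS n : `|q n.+1 - q n| < 2 * r n.
  have [z [z1 z2]] := filter_ex (filterI (qF n) (qF n.+1)).
  have := ball_triangle z1 (ball_sym z2); rewrite -ball_normE /= distrC.
  move=> /lt_le_trans; apply; rewrite mulrDl mul1r lerD2l [leRHS]rS.
  by rewrite lerDl ltW.
have /choice[y yP] n : exists y, quot_proj y = q n.+1 - q n /\ `|y| < 2 * r n.
  have d0 : 0 < 2 * r n - `|q n.+1 - q n| by rewrite subr_gt0.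
  have [y yq yn] := quot_norm_lt (q n.+1 - q n) d0; exists y; split => //.
  have E : `|q n.+1 - q n| = quot_norm (q n.+1 - q n) by [].
  by move: yn; rewrite -E addrC subrK.
pose x n := quot_repr (q 0) + \sum_(k < n) y k.
have xq n : quot_proj (x n) = q n.
  elim: n => [|n IH]; first by rewrite /x big_ord0 addr0 quot_reprK.
  rewrite /x big_ord_recr /= addrA quot_projD -/(x n) IH (yP n).1.
  by rewrite addrC subrK.
have xx n k : `|x n - x (n + k)%N| <= 4 * (r n - r (n + k)%N).
  elim: k => [|k IH]; first by rewrite addn0 !subrr normr0 mulr0.
  have -> : x n - x (n + k.+1)%N = (x n - x (n + k)%N) - y (n + k)%N.
    by rewrite addnS [x (_).+1]/x big_ord_recr/= addrA -/(x _) opprD addrA.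
  rewrite (le_trans (ler_normB _ _))//.
  rewrite (le_trans (lerD IH (ltW (yP _).2)))// addnS [r (n + k)%N]rS.
  set a := r n; set b := r _.
  have -> : 4 * (a - (b + b)) + 2 * (b + b) = 4 * (a - b) :> R[i] by ring.
  by [].
have xx' n m : (n <= m)%N -> `|x n - x m| < 4 * r n.
  move=> nm; have := xx n (m - n)%N; rewrite subnKC// => /le_lt_trans; apply.
  by rewrite ltr_pM2l// ltrBlDr ltrDl.
have cx : cauchy (x @ \oo).
  apply/cauchyP => e e0; have e40 : 0 < e / 4 by rewrite divr_gt0.
  have [n ne] := small_expn e40; exists (x n).
  exists n => // m /= nm; rewrite -ball_normE /=.
  by rewrite (lt_trans (xx' _ _ nm))// mulrC -ltr_pdivlMr.
have [l xl] : exists l : L, x @ \oo --> l by apply/cvg_ex; exact: cauchy_cvg.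
have lx n : `|l - x n| < 5 * r n.
  have /xl[N _ Nl] : nbhs l (ball l (r n)) by exact: nbhsx_ballx.
  have /Nl : (N <= maxn N n)%N by rewrite leq_maxl.
  rewrite -ball_normE /= => h1.
  have h2 := xx' n _ (leq_maxr N n).
  rewrite -(subrK (x (maxn N n)) l) -addrA (le_lt_trans (ler_normD _ _))//.
  rewrite distrC in h2; apply: lt_le_trans (ltrD h1 h2) _.
  by have -> : r n + 4 * r n = 5 * r n by ring.
apply/cvg_ex; exists (quot_proj l) => A /nbhs_ballP[e /= e0 eA].
have e60 : 0 < e / 6 by rewrite divr_gt0.
have [n ne] := small_expn e60.
apply: filterS (qF n) => z; rewrite -ball_normE /= => qz; apply: eA.
rewrite -ball_normE /= -(subrK (q n) (quot_proj l)) -addrA.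
rewrite (le_lt_trans (ler_normD _ _))//.
have h : `|quot_proj l - q n| < 5 * r n.
  by rewrite -xq -quot_projB; exact: le_lt_trans (quot_norm_le _) (lx n).
apply: lt_trans (ltrD h qz) _.
have -> : 5 * r n + r n = r n * 6 by ring.
by rewrite -ltr_pdivlMr.
Qed.

HB.instance Definition _ := Uniform_isComplete.Build quotLie quot_complete.

Definition quot_lie (p q : quotLie) : quotLie :=
  quot_proj (lie (quot_repr p) (quot_repr q)).

Lemma quot_projL x y : quot_proj (lie x y) = quot_lie (quot_proj x) (quot_proj y).
Proof.
have [I0 Il Ia _] := hI.
apply/esym/quot_projP; set a := quot_repr _; set b := quot_repr _.
have -> : lie a b - lie x y = (-1) *: lie b (a - x) + lie x (b - y).
  rewrite !lieBr scaleN1r opprB (lieC b x) (lieC b a) opprK.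
  by rewrite [- _ + _]addrC addrA subrK.
by apply: Il; apply: Ia; exact: quot_repr_proj.
Qed.

Lemma quot_lie_linearl q : linear (quot_lie^~ q).
Proof.
move=> c; elim/quot_ind => x; elim/quot_ind => y; elim/quot_ind: q => z.
rewrite -quot_proj_linear -!quot_projL -quot_proj_linear; congr quot_proj.
exact: lie_linearl.
Qed.

Lemma quot_lie_linearr q : linear (quot_lie q).
Proof.
move=> c; elim/quot_ind => x; elim/quot_ind => y; elim/quot_ind: q => z.
rewrite -quot_proj_linear -!quot_projL -quot_proj_linear; congr quot_proj.
exact: lie_linearr.
Qed.

Lemma quot_liexx q : quot_lie q q = 0.
Proof.
elim/quot_ind: q => x; rewrite -quot_projL liexx.
by rewrite -(subrr 0) quot_projB subrr.
Qed.

Lemma quot_lie_jacobi p q s : quot_lie p (quot_lie q s) +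
  quot_lie q (quot_lie s p) + quot_lie s (quot_lie p q) = 0.
Proof.
elim/quot_ind: p => x; elim/quot_ind: q => y; elim/quot_ind: s => z.
rewrite -!quot_projL -!quot_projD lie_jacobi.
by rewrite -(subrr 0) quot_projB subrr.
Qed.

Lemma quot_lie_bounded : exists2 t : R[i], 0 < t &
  forall p q, `|quot_lie p q| <= t * `|p| * `|q|.
Proof.
have [t t0 ht] := lie_bounded (s := L); exists t => // p q.
have key d : 0 < d -> `|quot_lie p q| <= t * (`|p| + d) * (`|q| + d).
  move=> d0; have [x xp xd] := quot_norm_lt p d0.
  have [y yq yd] := quot_norm_lt q d0.
  rewrite -{1}xp -{1}yq -quot_projL; apply: le_trans (quot_norm_le _) _.
  rewrite (le_trans (ht _ _))// ler_pM// ?mulr_ge0// ?ltW//.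
  by rewrite ltr_pM2l.
apply/ler_addgt0Pr => e e0.
pose k := t * (`|p| + `|q| + 1).
have k0 : 0 < k by rewrite mulr_gt0// ltr_wpDl// addr_ge0.
pose d := (e / k) / (1 + e / k).
have ek0 : 0 < e / k by rewrite divr_gt0.
have d0 : 0 < d by rewrite divr_gt0// addr_gt0.
have d1 : d <= 1 by rewrite ler_pdivrMr ?addr_gt0// mul1r lerDr.
have dk : d <= e / k by rewrite ler_pdivrMr ?addr_gt0// ler_peMr ?ltW// ltrDl.
apply: le_trans (key d d0) _.
have -> : t * (`|p| + d) * (`|q| + d) =
  t * `|p| * `|q| + d * (t * (`|p| + `|q| + d)) by ring.
rewrite lerD2l; apply: le_trans (_ : d * k <= _); last by rewrite -ler_pdivlMr.
by rewrite ler_pM2l// ler_pM2l// lerD2l.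
Qed.

HB.instance Definition _ := CompleteNormedModule_isBanachLie.Build R quotLie
  quot_lie_linearl quot_lie_linearr quot_liexx quot_lie_jacobi quot_lie_bounded.

End QuotLie.

Definition is_lie_morphism (R : realType) (L M : banachLieType R)
    (f : {linear L -> M}) : Prop :=
  [/\ forall x y, f (lie x y) = lie (f x) (f y),
      exists k : R[i], forall x, `|f x| <= k * `|x| & dense (range f)].

Definition lie_map (R : realType) : Type := forall L : banachLieType R, set L.

Section Preradicals.
Context {R : realType}.
Implicit Types P Q : lie_map R.

Definition preradical P : Prop :=
  (forall L, closed_ideal (P L)) /\
  (forall (L M : banachLieType R) (f : {linear L -> M}),
     is_lie_morphism f -> f @` P L `<=` P M).

(* P S for a closed subalgebra S of L, viewed as a subset of L; the value is
   the empty set when S is not a closed subalgebra. *)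
Definition sub_map P (L : banachLieType R) (S : set L) : set L :=
  [set x | exists (hS : closed_subalgebra S) (y : subLie hS),
             P (subLie hS) y /\ val y = x].

(* The preimage of P (L / I) in L for a closed ideal I of L; the value is the
   empty set when I is not a closed ideal. *)
Definition quot_map P (L : banachLieType R) (I : set L) : set L :=
  [set x | exists hI : closed_ideal I, P (quotLie hI) (quot_proj hI x)].

Definition lower_stable P : Prop := forall L, sub_map P (P L) = P L.

Definition upper_stable P : Prop :=
  forall L (hP : closed_ideal (P L)), P (quotLie hP) = [set 0].

Definition balanced P : Prop :=
  forall (L : banachLieType R) (I : set L),
    closed_ideal I -> sub_map P I `<=` P L.

Definition under_radical P : Prop :=
  [/\ preradical P, lower_stable P & balanced P].

Definition over_radical P : Prop :=
  [/\ preradical P, upper_stable P & balanced P].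

Definition radical P : Prop :=
  [/\ preradical P, lower_stable P, upper_stable P & balanced P].

Definition map_le P Q : Prop := forall L, P L `<=` Q L.

End Preradicals.

(* An ordinal is represented by a point of a well-ordered type and stands for
   the order type of the set of elements strictly below that point. *)
Record wordinal := Wordinal {
  word_sort :> eqType;
  word_le : rel word_sort;
  word_wo : well_order word_le;
  word_pt : word_sort
}.

Definition word_lt (a : wordinal) (x y : a) : Prop := ~~ word_le y x.

Definition wordinal_le (a b : wordinal) : Prop :=
  exists2 f : a -> b,
    forall x, word_lt x (word_pt a) -> word_lt (f x) (word_pt b) &
    forall x y, word_lt x y -> word_lt y (word_pt a) -> word_lt (f x) (f y).

Definition word_pred (a : wordinal) (v w : a) : Prop :=
  word_lt v w /\ forall x, word_lt x w -> word_le x v.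

Lemma word_le_anti (a : wordinal) (x y : a) :
  word_le x y -> word_le y x -> x = y.
Proof.
move=> xy yx; apply: (wo_chain_antisymmetric (C := predT)) => //.
  exact: withinW (@word_wo a).
by rewrite xy yx.
Qed.

Lemma word_lt_wf (a : wordinal) : well_founded (@word_lt a).
Proof.
move=> x; apply: contrapT => nx.
have ne : nonempty (fun y : a => `[< ~ Acc (@word_lt a) y >]).
  by exists x; apply/asboolP.
have [z [[/asboolP nz zmin] _]] := word_wo ne.
apply: nz; constructor => y yz; apply: contrapT => ny; move/negP: yz; apply.
by apply: zmin; apply/asboolP.
Qed.

Section TransfiniteIteration.
Variables (T : Type) (zero : T) (succ : T -> T) (lim : set T -> T).

Definition iter_step (a : wordinal) (w : a)
    (rec : forall v : a, word_lt v w -> T) : T :=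
  match pselect (exists v, word_pred v w) with
  | left h => succ (rec (projT1 (cid h)) (proj1 (projT2 (cid h))))
  | right _ =>
      if pselect (exists v, word_lt v w)
      then lim [set t | exists v (h : word_lt v w), rec v h = t]
      else zero
  end.

Definition iter_at (a : wordinal) (w : a) : T :=
  Fix (@word_lt_wf a) (fun _ => T) (@iter_step a) w.

Definition ord_iter (a : wordinal) : T := iter_at (word_pt a).

Lemma iter_atE (a : wordinal) (w : a) :
  iter_at w = iter_step (fun v (_ : word_lt v w) => iter_at v).
Proof.
rewrite /iter_at Fix_eq// => x f g fg.
suff -> : f = g by [].
by apply: functional_extensionality_dep => y; apply/funext => h.
Qed.

Lemma iter_at_zero (a : wordinal) (w : a) :
  (forall v, ~ word_lt v w) -> iter_at w = zero.
Proof.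
move=> h; rewrite iter_atE /iter_step.
case: pselect => [hp|_]; first by have [v [vw _]] := hp; case: (h v vw).
by case: pselect => [hv|//]; have [v vw] := hv; case: (h v vw).
Qed.

Lemma iter_at_succ (a : wordinal) (v w : a) :
  word_pred v w -> iter_at w = succ (iter_at v).
Proof.
move=> vw; rewrite iter_atE /iter_step; case: pselect => [h|[]]; last by exists v.
congr (succ (iter_at _)); have [uw umax] := projT2 (cid h).
by apply: word_le_anti; [apply: (proj2 vw) | apply: umax; apply: (proj1 vw)].
Qed.

Lemma iter_at_lim (a : wordinal) (w : a) :
  (exists v, word_lt v w) -> (forall v, ~ word_pred v w) ->
  iter_at w = lim [set iter_at v | v in [set v | word_lt v w]].
Proof.
move=> w0 nw; rewrite iter_atE /iter_step.
case: pselect => [hp|_]; first by have [v vw] := hp; case: (nw v vw).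
case: pselect => [w0'|//].
congr lim; apply/seteqP; split=> [t [v [h <-]]|t [v h <-]]; first by exists v.
by exists v, h.
Qed.

Definition stable_value (t : T) : Prop :=
  exists a, forall b, wordinal_le a b -> ord_iter b = t.

End TransfiniteIteration.

Section Radicalizations.
Context {R : realType}.

(* The default value set0 of xget is only returned by a chain with no stable
   value. *)
Definition circ_map (P : lie_map R) : lie_map R := fun L =>
  xget set0 (stable_value setT (@sub_map R P L)
    (fun F => \bigcap_(A in F) A)).

Definition star_map (P : lie_map R) : lie_map R := fun L =>
  xget set0 (stable_value [set 0] (@quot_map R P L)
    (fun F => closure (\bigcup_(A in F) A))).

Definition smallest_radical_above (P Q : lie_map R) : Prop :=
  [/\ radical Q, map_le P Q &
      forall S, radical S -> map_le P S -> map_le Q S].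

Definition largest_radical_below (P Q : lie_map R) : Prop :=
  [/\ radical Q, map_le Q P &
      forall S, radical S -> map_le S P -> map_le S Q].

End Radicalizations.

(* Main.v *)
(** By Cantor's theorem a chain of subsets of L cannot be injective on a long
    ordinal, so the star chain stabilizes at the least closed ideal J with
    R(L/J) = 0, and the circle chain at the greatest closed ideal I with
    R(I) = I; all further arguments use these characterizations.

    Both rest on the fact that R(I) is an ideal of L, not only of I, when I is a
    closed ideal of L: for x in L the automorphisms exp(s ad x) of I preserve
    R(I), hence so does their derivative ad x at s = 0.

    The two delicate points are that R* is lower stable and that R° is upper
    stable.  In each case one factors a homomorphism through a quotient map and
    plays a subalgebra on which R is everything against a quotient on which R
    vanishes. *)
From HB Require Import structures.
From mathcomp Require Import all_boot all_order all_algebra.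
From mathcomp Require Import complex.
From mathcomp Require Import mathcomp_extra boolp classical_sets wochoice.
Require Import Defs.
From mathcomp Require Import reals topology normedtype ring.

Set Implicit Arguments.
Unset Strict Implicit.
Unset Printing Implicit Defensive.

Import Order.TTheory GRing.Theory Num.Theory.
Import numFieldNormedType.Exports.

Local Open Scope classical_set_scope.
Local Open Scope ring_scope.
Local Open Scope complex_scope.

(** * Well-orders and their ordinal sums *)

Section WellOrders.

Definition sum_rel (A B : Type) (r : rel A) (s : rel B) : rel (A + B) :=
  fun x y => match x, y with
  | inl x, inl y => r x y
  | inr x, inr y => s x y
  | inl _, inr _ => true
  | inr _, inl _ => false
  end.

(** The minimum is sought in the left summand, and in the right one only when the left part is
    empty. Sums serve to lengthen ordinals. *)
Lemma well_order_sum (A B : Type) (r : rel A) (s : rel B) :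
  well_order r -> well_order s -> well_order (sum_rel r s).
Proof.
move=> wr ws C [c Cc].
have [[x Cx]|nC] := pselect (exists x, inl x \in C).
  have [|z [[Cz zmin] zuniq]] := wr (fun x => inl x \in C); first by exists x.
  exists (inl z); split; first by split=> // -[y|y] Cy //=; exact: zmin.
  move=> [y|y] [Cy ymin]; last by have := ymin _ Cz.
  by congr inl; apply: zuniq; split=> // t Ct; exact: (ymin (inl t)).
case: c Cc => [x Cx|x Cx]; first by case: nC; exists x.
have [|z [[Cz zmin] zuniq]] := ws (fun x => inr x \in C); first by exists x.
exists (inr z); split.
  by split=> // -[y|y] Cy //=; [case: nC; exists y | exact: zmin].
move=> [y|y] [Cy ymin]; first by case: nC; exists y.
by congr inr; apply: zuniq; split=> // t Ct; exact: (ymin (inr t)).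
Qed.

Lemma well_order_unit : well_order (fun _ _ : unit => true).
Proof.
move=> C [[] Ct]; exists tt; split; first by split.
by move=> [].
Qed.

Variable a : wordinal.
Implicit Types x y z : a.

Lemma word_le_total x y : word_le x y \/ word_le y x.
Proof.
have ne : wochoice.nonempty (fun z => (z == x) || (z == y)).
  by exists x; rewrite unfold_in eqxx.
have [z [[+ zmin] _]] := word_wo ne; rewrite unfold_in.
have zx : word_le z x by apply: zmin; rewrite unfold_in eqxx.
have zy : word_le z y by apply: zmin; rewrite unfold_in eqxx orbT.
by move=> /orP[]/eqP zE; subst z; [left|right].
Qed.

Lemma word_le_trans x y z : word_le x y -> word_le y z -> word_le x z.
Proof.
move=> xy yz.
have ne : wochoice.nonempty (fun t => [|| t == x, t == y | t == z]).
  by exists x; rewrite unfold_in eqxx.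
have [t [[+ tmin] _]] := word_wo ne; rewrite unfold_in.
have tx : word_le t x by apply: tmin; rewrite unfold_in eqxx.
have ty : word_le t y by apply: tmin; rewrite unfold_in eqxx orbT.
have tz : word_le t z by apply: tmin; rewrite unfold_in eqxx !orbT.
move=> /or3P[]/eqP tE; subst t => //.
  by rewrite (word_le_anti xy tx).
by rewrite -(word_le_anti yz ty).
Qed.

Lemma word_le_refl x : word_le x x.
Proof. by case: (word_le_total x x). Qed.

Lemma word_ltW x y : word_lt x y -> word_le x y.
Proof. by rewrite /word_lt; case: (word_le_total x y) => // ->. Qed.

Lemma word_lt_le_trans x y z : word_lt x y -> word_le y z -> word_lt x z.
Proof. by move=> xy yz; apply: contra xy; exact: word_le_trans. Qed.

Lemma word_le_eqVlt x y : word_le x y -> x = y \/ word_lt x y.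
Proof.
move=> xy; have [yx|yx] := boolP (word_le y x); last by right.
by left; exact: word_le_anti.
Qed.

Lemma word_succ_ex x y : word_lt x y ->
  exists2 z, word_pred x z & word_le z y.
Proof.
move=> xy; have ne : wochoice.nonempty (fun t => ~~ word_le t x) by exists y.
have [z [[xz zmin] _]] := word_wo ne; exists z; last exact: zmin.
split=> // t tz; have [//|tx] := boolP (word_le t x).
by move: tz; rewrite /word_lt zmin.
Qed.

End WellOrders.

(** * Stabilization of transfinite chains *)

Section StableValue.
Variables (T : Type) (zero : T) (succ : T -> T) (lim : set T -> T).
(** An abstract setting for both chains: [good] becomes being a closed ideal, and [le] becomes
    inclusion for the star chain and reverse inclusion for the circle chain. Limits are taken along
    nonempty chains, since the union of ideals must again be an ideal. *)
Variables (good : T -> Prop) (le : T -> T -> Prop).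
Hypothesis le_refl : forall x, le x x.
Hypothesis le_trans : forall y x z, le x y -> le y z -> le x z.
Hypothesis le_anti : forall x y, le x y -> le y x -> x = y.
Hypothesis good_zero : good zero.
Hypothesis zero_le : forall z, good z -> le zero z.
Hypothesis good_succ : forall x, good x -> good (succ x).
Hypothesis le_succ : forall x, good x -> le x (succ x).
Hypothesis succ_le : forall x z,
  good x -> good z -> le (succ z) z -> le x z -> le (succ x) z.
Hypothesis good_lim : forall F : set T, F !=set0 -> F `<=` good ->
  (forall x y, F x -> F y -> le x y \/ le y x) -> good (lim F).
Hypothesis le_lim : forall (F : set T) x, F `<=` good -> F x -> le x (lim F).
Hypothesis lim_le : forall (F : set T) z, F !=set0 -> good z ->
  (forall x, F x -> le x z) -> le (lim F) z.

Let iter (a : wordinal) (w : a) := iter_at zero succ lim w.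

(** Transfinite induction with the recursion already unfolded in its zero, successor and limit
    cases. *)
Let iter_ind (a : wordinal) (Q : a -> T -> Prop) :
  (forall w, (forall v, ~ word_lt v w) -> Q w zero) ->
  (forall v w, word_pred v w -> (forall u, word_lt u w -> Q u (iter u)) ->
    Q w (succ (iter v))) ->
  (forall w, (exists v, word_lt v w) ->
    (forall u, word_lt u w -> Q u (iter u)) ->
    Q w (lim [set iter v | v in [set v | word_lt v w]])) ->
  forall w, Q w (iter w).
Proof.
move=> Q0 QS Ql w; elim/(well_founded_ind (@word_lt_wf a)): w => w IH.
rewrite /iter; have [[v vw]|nw] := pselect (exists v, word_pred v w).
  by rewrite (iter_at_succ _ _ _ vw); exact: QS.
have [[v vw]|n0] := pselect (exists v, word_lt v w).
  rewrite iter_at_lim; [by apply: Ql => //; exists v|by exists v|].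
  by move=> u uw; apply: nw; exists u.
have n0' v : ~ word_lt v w by move=> vw; apply: n0; exists v.
by rewrite iter_at_zero//; exact: Q0.
Qed.

(** Both claims need a joint induction: [le_succ] requires goodness, and goodness at a limit
    requires the earlier values to be comparable. *)
Let iter_good_le (a : wordinal) (w : a) :
  good (iter w) /\ forall v, word_lt v w -> le (iter v) (iter w).
Proof.
move: w; apply: (@iter_ind a
  (fun w t => good t /\ forall v, word_lt v w -> le (iter v) t)).
- by move=> w w0; split=> // v /w0.
- move=> v w [vw vmax] IH; have [gv lev] := IH v vw.
  split; first exact: good_succ.
  move=> u /vmax /word_le_eqVlt[->|uv]; first exact: le_succ.
  exact: le_trans (lev _ uv) (le_succ gv).
- move=> w [v0 v0w] IH; set F := [set _ | _ in _].
  have FG : F `<=` good by move=> _ [v /IH[gv _] <-].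
  split; last by move=> v vw; apply: le_lim => //; exists v.
  apply: good_lim => //; first by exists (iter v0), v0.
  move=> _ _ [v /IH[_ lv] <-] [u /IH[_ lu] <-].
  have [/word_le_eqVlt[->|vu]|/word_le_eqVlt[->|uv]] := word_le_total v u.
  + by left.
  + by left; exact: lu.
  + by left.
  + by right; exact: lv.
Qed.

Let iter_good (a : wordinal) (w : a) : good (iter w).
Proof. by have [] := iter_good_le w. Qed.

Let iter_le (a : wordinal) (v w : a) : word_le v w -> le (iter v) (iter w).
Proof.
by move=> /word_le_eqVlt[->//|]; have [_] := iter_good_le w; apply.
Qed.

(** This bound by every prefixed point is what makes the stable value the least one. *)
Let iter_prefixed (a : wordinal) (w : a) z :
  good z -> le (succ z) z -> le (iter w) z.
Proof.
move=> gz sz; move: w; apply: (@iter_ind a (fun _ t => le t z)).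
- by move=> *; exact: zero_le.
- by move=> v w [vw _] IH; apply: succ_le => //; exact: IH.
- move=> w [v vw] IH; apply: lim_le => //; first by exists (iter v), v.
  by move=> _ [u /IH uw <-].
Qed.

Definition large (b : wordinal) : Prop :=
  exists2 f : set T -> b, injective f & forall x, word_lt (f x) (word_pt b).

(* Before it becomes stationary the chain is injective, which Cantor's theorem
   forbids on an initial segment with at least as many points as [set T]. *)
Let large_fixed (b : wordinal) :
  large b -> succ (iter (word_pt b)) = iter (word_pt b).
Proof.
move=> [f finj fpt].
suff [v vpt sv] : exists2 v : b, word_lt v (word_pt b) & succ (iter v) = iter v.
  suff -> : iter (word_pt b) = iter v by [].
  apply: le_anti; last by apply: iter_le; exact: word_ltW.
  by apply: iter_prefixed; rewrite ?sv.
apply: contrapT => nfix.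
(* If the values at [v < w] agree, the value at the successor of [v] is squeezed between them, so
   the chain is already fixed at [v]. *)
have iter_neq (v w : b) : word_lt v w -> word_lt w (word_pt b) ->
    iter v <> iter w.
  move=> vw wpt E; apply: nfix; exists v.
    exact: word_lt_le_trans vw (word_ltW wpt).
  have [u vu uw] := word_succ_ex vw.
  have su : iter u = succ (iter v) by rewrite /iter (iter_at_succ _ _ _ vu).
  apply: le_anti; last exact: le_succ.
  by rewrite -su E; exact: iter_le.
have ginj (A B : set T) : iter (f A) = iter (f B) -> A = B.
  move=> E; apply: finj.
  have [/word_le_eqVlt[//|]|/word_le_eqVlt[//|]] := word_le_total (f A) (f B).
    by move=> /iter_neq /(_ (fpt _)).
  by move=> /iter_neq /(_ (fpt _)) /nesym.
(* Cantor's diagonal set for the injection sending [A] to [iter (f A)]. *)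
pose D : set T := [set x | exists2 A : set T, iter (f A) = x & ~ A x].
have [DD|nDD] := pselect (D (iter (f D))).
  by have [A /ginj AD] := DD; rewrite AD.
by apply: (nDD); exists D.
Qed.

Let large_le (a b : wordinal) : wordinal_le a b -> large a -> large b.
Proof.
move=> [g gpt gmono] [f finj fpt].
exists (g \o f) => [A B /= E|A]; last exact: gpt.
apply: finj.
have [/word_le_eqVlt[//|lt]|/word_le_eqVlt[//|lt]] := word_le_total (f A) (f B).
  by have := gmono _ _ lt (fpt _); rewrite E /word_lt word_le_refl.
by have := gmono _ _ lt (fpt _); rewrite E /word_lt word_le_refl.
Qed.

(** The ordinal is [a], followed by a well-ordering of [set T], followed by one last point; marking
    that point puts everything else strictly below it. *)
Let large_ex (a : wordinal) : exists2 b, wordinal_le a b & large b.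
Proof.
have [r wr] := well_ordering_principle (set T).
pose wo := well_order_sum (@word_wo a) (well_order_sum wr well_order_unit).
exists (@Wordinal (a + (set T + unit))%type _ wo (inr (inr tt))).
  by exists inl.
by exists (inr \o inl) => [A B []|].
Qed.

(** Values at large ordinals are fixed, hence prefixed, hence bound one another and coincide. Any
    stable value is also attained at some large ordinal, which gives uniqueness. *)
Lemma stable_value_ex : exists e,
  [/\ good e, succ e = e,
      forall z, good z -> le (succ z) z -> le e z,
      stable_value zero succ lim e &
      forall t, stable_value zero succ lim t -> t = e].
Proof.
have [a _ La] := large_ex (@Wordinal unit _ well_order_unit tt).
have iterE b : large b -> iter (word_pt b) = iter (word_pt a).
  by move=> Lb; apply: le_anti; apply: iter_prefixed; rewrite ?large_fixed.
exists (iter (word_pt a)); split=> //; first exact: large_fixed.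
- by move=> z gz sz; exact: iter_prefixed.
- by exists a => b /large_le/(_ La); exact: iterE.
- move=> t [a' ta']; have [b a'b Lb] := large_ex a'.
  by rewrite -(ta' b a'b); exact: iterE.
Qed.

End StableValue.

(** * Closure and density in terms of the norm *)

Section ComplexNormed.
Context {R : realType}.

Lemma closure_normP (V : normedModType R[i]) (A : set V) x :
  closure A x <-> forall e : R[i], 0 < e -> exists2 y, A y & `|x - y| < e.
Proof.
split=> [Ax e e0|Ax B /nbhs_ballP[e /= e0 eB]].
  have [y [Ay]] := Ax _ (nbhsx_ballx x e e0).
  by rewrite -ball_normE /= => xy; exists y.
have [y Ay xy] := Ax e e0; exists y; split=> //.
by apply: eB; rewrite -ball_normE.
Qed.

Lemma denseE (V : normedModType R[i]) (A : set V) :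
  dense A <-> forall x, closure A x.
Proof.
split=> [dA x B /nbhs_ballP[e /= e0 eB]|cA O [x Ox] oO].
  have [|y [+ Ay]] := dA _ _ (open_interior B).
    by exists x; apply/nbhs_ballP; exists e.
  by move=> /interior_subset By; exists y.
by have [y [Ay Oy]] := cA x O (open_nbhs_nbhs (conj oO Ox)); exists y.
Qed.

Lemma Lipschitz_closure (V W : normedModType R[i]) (f : V -> W) (k : R[i])
    (A : set V) x : 0 <= k -> (forall x y, `|f x - f y| <= k * `|x - y|) ->
  closure A x -> closure (f @` A) (f x).
Proof.
move=> k0 fk /closure_normP Ax; apply/closure_normP => e e0.
(* Division is by [k + 1] because [k] may vanish. *)
have k1 : 0 < k + 1 by rewrite ltr_wpDl.
have [|y Ay xy] := Ax (e / (k + 1)); first by rewrite divr_gt0.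
exists (f y); first by exists y.
apply: le_lt_trans (fk _ _) _; move: xy; rewrite ltr_pdivlMr// mulrC.
by apply: le_lt_trans; rewrite ler_wpM2r// lerDl.
Qed.

End ComplexNormed.

(** * Bilinearity of the bracket *)

Section LieLinear.
Context {R : realType} {L : banachLieType R}.
Implicit Types x y z : L.

Lemma lieDl x y z : lie (x + y) z = lie x z + lie y z.
Proof. by have /= := lie_linearl z 1 x y; rewrite !scale1r. Qed.

Lemma lieDr x y z : lie z (x + y) = lie z x + lie z y.
Proof. by have /= := lie_linearr z 1 x y; rewrite !scale1r. Qed.

Lemma lie0l z : lie 0 z = 0.
Proof. by have := lieBl 0 0 z; rewrite !subrr. Qed.

Lemma lie0r z : lie z 0 = 0.
Proof. by have := lieBr 0 0 z; rewrite !subrr. Qed.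

Lemma lieZl a x z : lie (a *: x) z = a *: lie x z.
Proof. by have /= := lie_linearl z a x 0; rewrite lie0l !addr0. Qed.

Lemma lieZr a x z : lie z (a *: x) = a *: lie z x.
Proof. by have /= := lie_linearr z a x 0; rewrite lie0r !addr0. Qed.

End LieLinear.

(** * Bounded Lie homomorphisms, subalgebras and quotients *)

Section Homs.
Context {R : realType}.
Implicit Types L M A B C : banachLieType R.

(** A predicate on bare functions, so that maps obtained by choice or composition carry no bundled
    structure. Density of the range is kept apart, since inclusions of ideals lack it. *)
Definition lie_hom L M (f : L -> M) : Prop :=
  [/\ linear f, forall x y, f (lie x y) = lie (f x) (f y) &
      exists2 k : R[i], 0 <= k & forall x, `|f x| <= k * `|x|].

Definition dense_range L M (f : L -> M) : Prop := forall y, closure (range f) y.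

(** For a homomorphism this makes the closure of the range an ideal. It covers both dense maps and
    inclusions of ideals. *)
Definition ideal_range L M (f : L -> M) : Prop :=
  forall y x, closure (range f) (lie y (f x)).

Lemma morphism_lie_hom L M (f : {linear L -> M}) :
  is_lie_morphism f -> lie_hom f /\ dense_range f.
Proof.
move=> [fl [k fk] df]; split; last exact: (denseE _).1 df.
split=> //; first exact: linearP.
exists `|k| => // x; have /ger0_norm : 0 <= k * `|x|.
  exact: le_trans (fk x).
by rewrite normrM normr_id => ->.
Qed.

Section Hom.
Context {L M : banachLieType R} {f : L -> M}.
Hypothesis fH : lie_hom f.

Lemma homB x y : f (x - y) = f x - f y.
Proof.
have [fl _ _] := fH; rewrite addrC -scaleN1r fl scaleN1r.
exact: addrC.
Qed.

Lemma hom0 : f 0 = 0.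
Proof. by rewrite -(subrr 0) homB subrr. Qed.

Lemma homP c x y : f (c *: x + y) = c *: f x + f y.
Proof. by have [fl _ _] := fH; exact: fl. Qed.

Lemma homD x y : f (x + y) = f x + f y.
Proof. by rewrite -[x]scale1r homP !scale1r. Qed.

Lemma homL x y : f (lie x y) = lie (f x) (f y).
Proof. by have [_ fl _] := fH; exact: fl. Qed.

Lemma hom_closure (A : set L) x : closure A x -> closure (f @` A) (f x).
Proof.
have [_ _ [k k0 fk]] := fH; apply: (Lipschitz_closure k0) => y z.
by rewrite -homB.
Qed.

Lemma preimage_closed_ideal (J : set M) :
  closed_ideal J -> closed_ideal (f @^-1` J).
Proof.
move=> [J0 Jl Ja Jc]; split=> /=; first by rewrite hom0.
- by move=> c x y Jx Jy; rewrite homP; exact: Jl.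
- by move=> x y Jy; rewrite homL; exact: Ja.
- move=> x /hom_closure Jx; apply: Jc.
  by apply: closureS Jx => _ [y /= Jy <-].
Qed.

End Hom.

Lemma lie_hom_id L : lie_hom (@id L).
Proof. by split=> //; exists 1 => // x; rewrite mul1r. Qed.

Lemma lie_hom_comp L M A (f : L -> M) (g : M -> A) :
  lie_hom f -> lie_hom g -> lie_hom (g \o f).
Proof.
move=> fH gH; split=> [c x y|x y|] /=; first by rewrite (homP fH) (homP gH).
  by rewrite (homL fH) (homL gH).
have [_ _ [k k0 fk]] := fH; have [_ _ [l l0 gl]] := gH.
exists (l * k) => [|x]; first exact: mulr_ge0.
by rewrite (le_trans (gl _))// -mulrA ler_wpM2l.
Qed.

Lemma dense_range_comp L M A (f : L -> M) (g : M -> A) :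
  lie_hom g -> dense_range f -> dense_range g -> dense_range (g \o f).
Proof.
move=> gH fD gD y; apply: closed_closure; apply: closureS (gD y) => _ [x _ <-].
apply: closureS (hom_closure gH (fD x)) => _ [_ [z _ <-] <-].
by exists z.
Qed.

Lemma surj_dense_range L M (f : L -> M) :
  (forall y, exists x, f x = y) -> dense_range f.
Proof. by move=> fs y; apply: subset_closure; have [x] := fs y; exists x. Qed.

Lemma dense_ideal_range L M (f : L -> M) : dense_range f -> ideal_range f.
Proof. by move=> fD y x; exact: fD. Qed.

Lemma closed_idealW L (I : set L) : closed_ideal I -> closed_subalgebra I.
Proof. by move=> [I0 Il Ia Ic]; split=> // x y _; exact: Ia. Qed.

Lemma adB_le L (x : L) : exists2 k : R[i], 0 <= k &
  forall y z, `|lie x y - lie x z| <= k * `|y - z|.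
Proof.
have [t t0 ht] := @lie_bounded R L.
exists (t * `|x|) => [|y z]; first by rewrite mulr_ge0// ltW.
by rewrite -lieBr.
Qed.

(** Brackets may leave [I] as long as they stay in its closure, which is the situation of a range
    satisfying [ideal_range]. *)
Lemma closed_ideal_closure L (I : set L) : I 0 ->
  (forall (c : R[i]) x y, I x -> I y -> I (c *: x + y)) ->
  (forall x y, I y -> closure I (lie x y)) -> closed_ideal (closure I).
Proof.
move=> I0 Il Ia; split; first exact: subset_closure.
- move=> c x y /closure_normP Ix /closure_normP Iy.
  apply/closure_normP => e e0; have e20 : 0 < e / 2 by rewrite divr_gt0.
  have c1 : 0 < `|c| + 1 by rewrite ltr_wpDl.
  have [|u Iu xu] := Ix (e / 2 / (`|c| + 1)); first by rewrite divr_gt0.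
  have [v Iv yv] := Iy _ e20; exists (c *: u + v); first exact: Il.
  rewrite opprD addrACA -scalerBr (le_lt_trans (ler_normD _ _))//.
  rewrite [ltRHS](splitr e) ler_ltD// normrZ.
  move: xu; rewrite ltr_pdivlMr// => /ltW; apply: le_trans.
  by rewrite mulrC ler_wpM2l// lerDl.
- move=> x y Iy; have [k k0 xk] := adB_le x.
  apply: closed_closure.
  by apply: closureS (Lipschitz_closure k0 xk Iy) => _ [z Iz <-]; exact: Ia.
- exact: closed_closure.
Qed.

Lemma closed_ideal_range L M (f : L -> M) : lie_hom f -> ideal_range f ->
  closed_ideal (closure (range f)).
Proof.
move=> fH fI; apply: closed_ideal_closure.
- by exists 0 => //; exact: hom0.
- move=> c _ _ [x _ <-] [y _ <-]; exists (c *: x + y) => //.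
  by rewrite (homP fH).
- by move=> x _ [y _ <-]; exact: fI.
Qed.

Section SubHoms.
Context {L : banachLieType R} {S : set L}.
Variable hS : closed_subalgebra S.

Definition sub_val (x : subLie hS) : L := val x.

Lemma lie_hom_val : lie_hom sub_val.
Proof. by split=> //; exists 1 => // x; rewrite mul1r. Qed.

Lemma sub_valP x : S (sub_val x).
Proof. exact: subLieP. Qed.

Lemma sub_val_inj : injective sub_val.
Proof. exact: val_inj. Qed.

Lemma sub_val_ex x : S x -> exists y, sub_val y = x.
Proof.
move=> Sx; have px : sub_pred hS x by rewrite /sub_pred inE.
by exists (Sub x px); rewrite /sub_val SubK.
Qed.

Lemma corestriction A (f : A -> L) : lie_hom f -> (forall x, S (f x)) ->
  exists2 g : A -> subLie hS, lie_hom g & forall x, sub_val (g x) = f x.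
Proof.
move=> fH fS; have /choice[g gf] x : exists y, sub_val y = f x.
  exact: sub_val_ex.
exists g => //; split=> [c x y|x y|].
- by apply: sub_val_inj; rewrite (homP lie_hom_val) !gf (homP fH).
- by apply: sub_val_inj; rewrite (homL lie_hom_val) !gf (homL fH).
- by have [_ _ [k k0 fk]] := fH; exists k => // x; have := fk x; rewrite -gf.
Qed.

Lemma sub_closure (X : set (subLie hS)) x :
  closure (sub_val @` X) (sub_val x) -> closure X x.
Proof.
move=> /closure_normP Xx; apply/closure_normP => e /Xx[_ [y Xy <-] xy].
by exists y.
Qed.

End SubHoms.

Lemma ideal_range_val L (I : set L) (hI : closed_subalgebra I) :
  (forall x y, I y -> I (lie x y)) -> ideal_range (sub_val (hS := hI)).
Proof.
move=> Ia y x; apply: subset_closure.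
by have [z <-] := sub_val_ex hI (Ia y _ (sub_valP x)); exists z.
Qed.

Section Quotients.
Context {L : banachLieType R} {I : set L}.
Variable hI : closed_ideal I.

Lemma lie_hom_proj : lie_hom (quot_proj hI).
Proof.
split; [exact: quot_proj_linear|exact: quot_projL|].
by exists 1 => // x; rewrite mul1r; exact: quot_norm_le.
Qed.

Lemma quot_proj_surj q : exists x, quot_proj hI x = q.
Proof. by exists (quot_repr q); exact: quot_reprK. Qed.

Lemma quot_proj_eq0 x : quot_proj hI x = 0 <-> I x.
Proof. by rewrite -(hom0 lie_hom_proj) quot_projP subr0. Qed.

Lemma quot_proj_eq0W x : I x -> quot_proj hI x = 0.
Proof. by move/quot_proj_eq0. Qed.

End Quotients.

(** The property of a quotient norm that makes factored maps bounded. It is isolated because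
    restrictions of a quotient map to preimages of subalgebras share it. *)
Definition norm_lifting L M (f : L -> M) : Prop :=
  forall (y : M) (e : R[i]), 0 < e -> exists2 x, f x = y & `|x| < `|y| + e.

Lemma norm_lifting_surj L M (f : L -> M) y :
  norm_lifting f -> exists x, f x = y.
Proof. by move=> /(_ y 1 ltr01)[x xy _]; exists x. Qed.

Lemma norm_lifting_proj L (I : set L) (hI : closed_ideal I) :
  norm_lifting (quot_proj hI).
Proof. by move=> y e; exact: quot_norm_lt. Qed.

(** The kernel condition makes [g] independent of the chosen lift along [f]; taking nearly optimal
    lifts, the factored map inherits the bound of [g]. *)
Lemma hom_factor A B C (f : A -> B) (g : A -> C) : lie_hom f ->
  norm_lifting f -> lie_hom g -> (forall x, f x = 0 -> g x = 0) ->
  exists2 h : B -> C, lie_hom h & forall x, h (f x) = g x.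
Proof.
move=> fH fl gH fg; have [s sK] := choice (fun y => norm_lifting_surj y fl).
have gf x y : f x = f y -> g x = g y.
  move=> E; apply/eqP; rewrite -subr_eq0 -(homB gH); apply/eqP/fg.
  by rewrite (homB fH) E subrr.
exists (g \o s) => [|x]; last by apply: gf; rewrite sK.
split=> [c x y|x y|] /=.
- by rewrite -(homP gH); apply: gf; rewrite (homP fH) !sK.
- by rewrite -(homL gH); apply: gf; rewrite (homL fH) !sK.
- have [_ _ [k k0 gk]] := gH; exists k => // y.
  have k1 : 0 < k + 1 by rewrite ltr_wpDl.
  apply/ler_addgt0Pr => e e0.
  have [|x xy xe] := fl y (e / (k + 1)); first by rewrite divr_gt0.
  have -> : g (s y) = g x by apply: gf; rewrite sK.
  rewrite (le_trans (gk x))// (le_trans (ler_wpM2l k0 (ltW xe)))//.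
  rewrite mulrDr lerD2l mulrCA -[leRHS]mulr1 ler_wpM2l ?ltW//.
  by rewrite ltr_pdivrMr// mul1r ltrDl.
Qed.

Lemma ideal_range_comp_surj L M A (f : L -> M) (g : M -> A) : lie_hom g ->
  ideal_range f -> (forall y, exists x, g x = y) -> ideal_range (g \o f).
Proof.
move=> gH fI gs y x; have [u <-] := gs y; rewrite /= -(homL gH).
apply: closureS (hom_closure gH (fI u x)) => _ [_ [z _ <-] <-].
by exists z.
Qed.

Lemma ideal_range_factor A B C (f : A -> B) (g : A -> C) (h : B -> C) :
  (forall y, exists x, f x = y) -> (forall x, h (f x) = g x) ->
  ideal_range g -> ideal_range h.
Proof.
move=> fs hE gI y b; have [x <-] := fs b; rewrite hE.
by apply: closureS (gI y x) => _ [z _ <-]; exists (f z).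
Qed.

Lemma ideal_inclusion L (I J : set L) (hI : closed_ideal I)
    (sJ : closed_subalgebra J) : I `<=` J ->
  exists i : subLie (closed_idealW hI) -> subLie sJ,
    [/\ lie_hom i, ideal_range i & forall x, sub_val (i x) = sub_val x].
Proof.
move=> IJ.
have [|i iH iE] := corestriction sJ (lie_hom_val (closed_idealW hI)).
  by move=> x; apply: IJ; exact: sub_valP.
exists i; split=> // y x; apply: subset_closure; have [_ _ Ia _] := hI.
have /(sub_val_ex (closed_idealW hI))[w wE] : I (lie (sub_val y) (sub_val x)).
  by apply: Ia; exact: sub_valP.
exists w => //; apply: (@sub_val_inj _ _ sJ).
by rewrite iE wE (homL (lie_hom_val sJ)) iE.
Qed.

(** Every lift of an element of [K] lies in the preimage of [K], so nearly optimal lifts remain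
    available after restriction. *)
Lemma sub_quot_lifting L (J : set L) (hJ : closed_ideal J)
    (K : set (quotLie hJ)) (sK : closed_subalgebra K)
    (sK' : closed_subalgebra (quot_proj hJ @^-1` K)) :
  exists f : subLie sK' -> subLie sK, [/\ lie_hom f, norm_lifting f &
    forall x, sub_val (f x) = quot_proj hJ (sub_val x)].
Proof.
have [|f fH fE] := corestriction sK
  (lie_hom_comp (lie_hom_val sK') (lie_hom_proj hJ)).
  by move=> x; exact: (sub_valP x).
exists f; split=> // y e e0.
have [x xy xe] := norm_lifting_proj (sub_val y) e0.
have /(sub_val_ex sK')[x' x'E] : (quot_proj hJ @^-1` K) x.
  by rewrite /= xy; exact: sub_valP.
exists x'; last by move: xe; rewrite -x'E.
by apply: sub_val_inj; rewrite fE /= x'E.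
Qed.

End Homs.

(** * Preradicals along homomorphisms *)

Section PreradicalHoms.
Context {R : realType}.
Implicit Types (P : lie_map R) (A B : banachLieType R).

Lemma preradical_hom P A B (f : A -> B) : preradical P ->
  lie_hom f -> dense_range f -> forall x, P A x -> P B (f x).
Proof.
move=> hP [fl fL [k k0 fk]] fD x Px.
pose F : {linear A -> B} :=
  HB.pack f (GRing.isLinear.Build _ _ _ _ f fl).
apply: (proj2 hP A B F); last by exists x.
by split=> //; [exists k|apply/denseE].
Qed.

(** The map is dense into the closure of its range, where the preradical property applies; that
    closure is a closed ideal of [B], where balance applies. *)
Lemma balanced_hom P A B (f : A -> B) : preradical P -> balanced P ->
  lie_hom f -> ideal_range f -> forall x, P A x -> P B (f x).
Proof.
move=> hP bP fH fI x Px; have IC := closed_ideal_range fH fI.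
have [|g gH gf] := corestriction (closed_idealW IC) fH.
  by move=> y; apply: subset_closure; exists y.
have gD : dense_range g.
  move=> y; apply: sub_closure; apply: closureS (sub_valP y) => _ [z _ <-].
  by exists (g z); [exists z|].
apply: (bP _ _ IC); exists (closed_idealW IC), (g x); split; last exact: gf.
exact: (preradical_hom hP gH gD).
Qed.

End PreradicalHoms.

(** * Exponentials of small bounded derivations *)

Section Exponential.
Context {R : realType}.

Lemma geometric_eq0 (V : normedModType R[i]) (x : V) (C : R[i]) :
  (forall n, `|x| <= C * 2^-1 ^+ n) -> x = 0.
Proof.
move=> xC; apply/eqP; apply: contrapT => /negP x0.
have C0 : 0 <= C by have := xC 0%N; rewrite expr0 mulr1; exact: le_trans.
have C1 : 0 < C + 1 by rewrite ltr_wpDl.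
have [|n] := @small_expn R (`|x| / (C + 1)).
  by rewrite divr_gt0// normr_gt0.
rewrite ltr_pdivlMr// mulrC => nx; have := lt_le_trans nx (xC n).
by rewrite ltr_pM2r ?exprn_gt0 ?invr_gt0// gtrDl ltr10.
Qed.

(** The bound [c <= 2^-1] only forces convergence; the rate stays [c ^+ n], so that the error after
    two terms is quadratic in [c]. *)
Lemma geometric_cvg (V : completeNormedModType R[i]) (u : nat -> V)
    (C c : R[i]) :
  0 <= c <= 2^-1 -> (forall n k, `|u (n + k)%N - u n| <= C * c ^+ n) ->
  exists l, forall n, `|l - u n| <= C * c ^+ n.
Proof.
move=> /andP[c0 c2] uC.
have C0 : 0 <= C.
  by have := uC 0%N 0%N; rewrite expr0 mulr1 subrr normr0.
have C1 : 0 < C + 1 by rewrite ltr_wpDl.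
have cu : cauchy (u @ \oo).
  apply/cauchyP => e e0; have [|n ne] := @small_expn R (e / (C + 1)).
    by rewrite divr_gt0.
  exists (u n); exists n => // m /= nm; rewrite -ball_normE /= distrC.
  have := uC n (m - n)%N; rewrite subnKC// => /le_lt_trans; apply.
  move: ne; rewrite ltr_pdivlMr// mulrC; apply: le_lt_trans.
  apply: ler_pM => //; [exact: exprn_ge0|by rewrite lerDl|].
  by apply: lerXn2r; rewrite // nnegrE ?invr_ge0.
have [l ul] : exists l : V, u @ \oo --> l by apply/cvg_ex; exact: cauchy_cvg.
exists l => n; apply/ler_addgt0Pr => e e0.
have /ul[N _ Nl] : nbhs l (ball l e) by exact: nbhsx_ballx.
have /Nl : (N <= n + N)%N by rewrite leq_addl.
rewrite -ball_normE /= => /ltW lu.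
rewrite -(subrK (u (n + N)%N) l) -addrA (le_trans (ler_normD _ _))//.
by rewrite [leRHS]addrC lerD ?uC.
Qed.

Context {A : banachLieType R}.
Implicit Types x y z : A.

(* The Neumann series for the inverse of [f]. *)
Lemma near_id_dense_range (f : A -> A) : lie_hom f ->
  (forall y, `|f y - y| <= 2^-1 * `|y|) -> dense_range f.
Proof.
move=> fH fy y; apply/closure_normP => e e0.
have rest n : exists x, `|y - f x| <= 2^-1 ^+ n * `|y|.
  elim: n => [|n [x xn]].
    by exists 0; rewrite (hom0 fH) subr0 expr0 mul1r.
  exists (x + (y - f x)).
  rewrite (homD fH) opprD addrA distrC (le_trans (fy _))// exprS -mulrA.
  by rewrite ler_wpM2l ?invr_ge0.
have y1 : 0 < `|y| + 1 by rewrite ltr_wpDl.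
have [|n ne] := @small_expn R (e / (`|y| + 1)); first by rewrite divr_gt0.
have [x xn] := rest n; exists (f x); first by exists x.
apply: le_lt_trans xn _; move: ne; rewrite ltr_pdivlMr//; apply: le_lt_trans.
by rewrite ler_wpM2l ?exprn_ge0 ?invr_ge0// lerDl.
Qed.

(** The term E^n y / n! of the exponential series. *)
Fixpoint exp_term (E : A -> A) n y : A :=
  if n is n'.+1 then n%:R^-1 *: E (exp_term E n' y) else y.

Variables (E : A -> A) (c : R[i]).
Hypothesis c0 : 0 <= c.
Hypothesis c4 : c <= 4^-1.
Hypothesis El : linear E.
Hypothesis Eder : forall y z, E (lie y z) = lie (E y) z + lie y (E z).
Hypothesis Ec : forall y, `|E y| <= c * `|y|.

Let t := exp_term E.
Let S n y := \sum_(i < n) t i y.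

Let ED y z : E (y + z) = E y + E z.
Proof. by rewrite -[y in LHS]scale1r El scale1r. Qed.

Let E0 : E 0 = 0.
Proof. by apply: (addIr (E 0)); rewrite -ED !add0r. Qed.

Let E_sum n (F : 'I_n -> A) : E (\sum_(i < n) F i) = \sum_(i < n) E (F i).
Proof. exact: (big_morph E ED E0). Qed.

Let t_linear n : linear (t n).
Proof.
move=> a y z; elim: n => //= n IH.
by rewrite /t /= -/t IH El scalerDr !scalerA mulrC.
Qed.

Let t_le n y : `|t n y| <= c ^+ n * `|y|.
Proof.
elim: n => [|n IH]; first by rewrite expr0 mul1r.
rewrite /t /= -/t normrZ exprS -mulrA.
apply: le_trans (_ : `|E (t n y)| <= _).
  rewrite ler_piMl// normfV normr_nat invf_le1 ?ltr0n//.
  by rewrite ler1n.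
by rewrite (le_trans (Ec _))// ler_wpM2l.
Qed.

Let E_t i y : E (t i y) = i.+1%:R *: t i.+1 y.
Proof. by rewrite /t /= scalerA divff ?scale1r// pnatr_eq0. Qed.

(** The Leibniz rule with factorials absorbed. After multiplication by [n.+1], the term of index [i]
    in the next sum receives the weights [i] and [n.+1 - i], which add up to [n.+1]. *)
Let t_lie n y z : t n (lie y z) = \sum_(i < n.+1) lie (t i y) (t (n - i) z).
Proof.
elim: n => [|n IH]; first by rewrite big_ord_recl big_ord0 addr0.
have n0 : n.+1%:R != 0 :> R[i] by rewrite pnatr_eq0.
apply: (scalerI n0); rewrite -E_t IH E_sum scaler_sumr.
under eq_bigr do rewrite Eder !E_t lieZl lieZr.
rewrite big_split /=.
have -> : \sum_(i < n.+1) i.+1%:R *: lie (t i.+1 y) (t (n - i) z) =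
    \sum_(i < n.+2) i%:R *: lie (t i y) (t (n.+1 - i) z).
  rewrite [RHS]big_ord_recl scale0r add0r.
  by apply: eq_bigr => i _.
have -> : \sum_(i < n.+1) (n - i).+1%:R *: lie (t i y) (t (n - i).+1 z) =
    \sum_(i < n.+2) (n.+1 - i)%:R *: lie (t i y) (t (n.+1 - i) z).
  rewrite [RHS]big_ord_recr /= subnn scale0r addr0.
  by apply: eq_bigr => i _; rewrite subSn// -ltnS.
rewrite -big_split; apply: eq_bigr => i _ /=.
by rewrite -scalerDl -natrD subnKC// -ltnS.
Qed.

Let S_cauchy n k y : `|S (n + k) y - S n y| <= 2 * `|y| * c ^+ n.
Proof.
(* The sharper bound telescopes over [k]: one more term costs [c ^+ (n + k)], which is covered
   because [2 * c <= 1]. *)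
suff : `|S (n + k) y - S n y| <= 2 * (c ^+ n - c ^+ (n + k)) * `|y|.
  move=> /le_trans; apply; rewrite mulrAC ler_wpM2l ?mulr_ge0//.
  by rewrite gerBl exprn_ge0.
elim: k => [|k IH]; first by rewrite addn0 !subrr mulr0 mul0r normr0.
rewrite addnS /S big_ord_recr /= -/(S _ _) addrAC.
rewrite (le_trans (ler_normD _ _))// (le_trans (lerD IH (t_le _ _)))//.
rewrite -mulrDl ler_wpM2r// exprS; set d := c ^+ (n + k).
have d0 : 0 <= d by exact: exprn_ge0.
rewrite -subr_ge0.
have -> : 2 * (c ^+ n - c * d) - (2 * (c ^+ n - d) + d) =
  d * (1 - 2 * c) by ring.
rewrite mulr_ge0// subr_ge0 -ler_pdivlMl// mulr1 (le_trans c4)//.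
by rewrite lef_pV2 ?posrE// ler_nat.
Qed.

(** The triangular sum over i + j < n, grouped by i. *)
Let S_lie n y z :
  \sum_(k < n) t k (lie y z) = \sum_(i < n) lie (t i y) (S (n - i) z).
Proof.
elim: n => [|n IH]; first by rewrite !big_ord0.
rewrite big_ord_recr IH /= t_lie [RHS]big_ord_recr /= big_ord_recr /=.
rewrite subnn subSnn addrA; congr (_ + _).
  rewrite -big_split; apply: eq_bigr => i _ /=.
  by rewrite subSn 1?ltnW// /S big_ord_recr /= lieDr.
by rewrite /S big_ord_recl big_ord0 addr0.
Qed.

(** The map is exp E, the limit of the partial sums [S n]. Each algebraic identity holds because its
    error is bounded by a constant times [2^-1 ^+ n] for all n. *)
Lemma exponential_ex : exists f : A -> A,
  [/\ lie_hom f, dense_range f &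
      forall y, `|f y - (y + E y)| <= 2 * `|y| * c ^+ 2].
Proof.
have c2 : c <= 2^-1 by rewrite (le_trans c4)// lef_pV2 ?posrE// ler_nat.
have cX n : c ^+ n <= 2^-1 ^+ n by apply: lerXn2r; rewrite // nnegrE ?invr_ge0.
have /choice[f fS] y : exists l, forall n, `|l - S n y| <= 2 * `|y| * c ^+ n.
  by apply: geometric_cvg => [|n k]; [rewrite c0|exact: S_cauchy].
have fS2 n y : `|f y - S n y| <= 2 * `|y| * 2^-1 ^+ n.
  by rewrite (le_trans (fS y n))// ler_wpM2l// mulr_ge0.
have S1 y : S 1 y = y by rewrite /S big_ord_recl big_ord0 addr0.
have f_le y : `|f y| <= 2 * `|y|.
  by have := fS y 0%N; rewrite /S big_ord0 subr0 expr0 mulr1.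
have S_le n y : `|S n y| <= 2 * `|y|.
  by have := S_cauchy 0 n y; rewrite /S add0n big_ord0 subr0 expr0 mulr1.
have S_lin n a y z : S n (a *: y + z) = a *: S n y + S n z.
  rewrite /S scaler_sumr -big_split; apply: eq_bigr => i _; exact: t_linear.
have [k k0 lk] := @lie_bounded R A.
have fH : lie_hom f.
  split; last by exists 2.
  - move=> a y z; apply/eqP; rewrite -subr_eq0; apply/eqP.
    apply: (@geometric_eq0 _ _
      (2 * `|a *: y + z| + (`|a| * (2 * `|y|) + 2 * `|z|))) => n.
    have -> : f (a *: y + z) - (a *: f y + f z) =
        (f (a *: y + z) - S n (a *: y + z)) -
        (a *: (f y - S n y) + (f z - S n z)).
      rewrite S_lin scalerBr addrACA -opprD.
      by rewrite [in RHS]opprB addrA subrK.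
    rewrite (le_trans (ler_normB _ _))// mulrDl lerD//.
    rewrite (le_trans (ler_normD _ _))// mulrDl lerD//.
    by rewrite normrZ -mulrA ler_wpM2l.
  - move=> y z; apply/eqP; rewrite -subr_eq0; apply/eqP.
    pose K := k * (2 * `|y|) * `|z|.
    have K0 : 0 <= K by rewrite !mulr_ge0// ltW.
    apply: (@geometric_eq0 _ _
      (2 * `|lie y z| + (K + (K *+ 2 + K *+ 2)))) => n.
    (* The square of indices exceeds the triangle by tails [S n z - S (n - i) z] of order
       [c ^+ (n - i)], so each of the n summands is at most [K * c ^+ n]. *)
    have defect : `|S n (lie y z) - lie (S n y) (S n z)| <= K * 2^-1 ^+ n.
      have -> : lie (S n y) (S n z) = \sum_(i < n) lie (t i y) (S n z).
        exact: (big_morph (fun x => lie x (S n z))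
          (fun x x' => lieDl x x' _) (lie0l _)).
      rewrite [S n (lie y z)]S_lie -sumrB (le_trans (ler_norm_sum _ _ _))//.
      apply: le_trans (_ : \sum_(i < n) K * c ^+ n <= _).
        apply: ler_sum => i _; rewrite -lieBr (le_trans (lk _ _))//.
        have iK := subnK (ltnW (ltn_ord i)).
        have := S_cauchy (n - i) i z; rewrite iK distrC => Si.
        have -> : K * c ^+ n =
            k * (c ^+ i * `|y|) * (2 * `|z| * c ^+ (n - i)).
          by rewrite -[in LHS]iK exprD /K; ring.
        apply: ler_pM => //; first by rewrite mulr_ge0// ltW.
        by rewrite ler_wpM2l ?(ltW k0).
      rewrite sumr_const card_ord -mulrnAr ler_wpM2l ?K0//.
      (* Here [c <= 4^-1] matters: one factor [2^-1 ^+ n] absorbs the number n of summands, the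
         other is the rate sought. *)
      rewrite -mulr_natr; apply: le_trans (_ : (4^-1 ^+ n) * n%:R <= _).
        by rewrite ler_wpM2r//; apply: lerXn2r; rewrite // nnegrE ?invr_ge0.
      have -> : 4^-1 = 2^-1 * 2^-1 :> R[i] by rewrite -invfM -natrM.
      rewrite exprMn -mulrA ler_piMr ?exprn_ge0 ?invr_ge0//.
      rewrite exprVn mulrC ler_pdivrMr ?exprn_gt0// mul1r -natrX ler_nat.
      by rewrite ltnW// ltn_expl.
    (* The errors are the tail at [lie y z], the defect of the partial sums, and the replacement of
       [S n] by [f] in each argument of the bracket. *)
    have -> : f (lie y z) - lie (f y) (f z) =
        (f (lie y z) - S n (lie y z)) +
        ((S n (lie y z) - lie (S n y) (S n z)) -
         (lie (f y - S n y) (S n z) + lie (f y) (f z - S n z))).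
      have telescope (p q r s u : A) :
          u - p = (u - s) + ((s - q) - ((r - q) + (p - r))).
        by rewrite [r - q + _]addrC subrKA opprB !addrA !subrK.
      by rewrite lieBl lieBr; exact: telescope.
    rewrite (le_trans (ler_normD _ _))// mulrDl lerD//.
    rewrite (le_trans (ler_normB _ _))// mulrDl lerD//.
    rewrite (le_trans (ler_normD _ _))// mulrDl lerD//.
      have -> : K *+ 2 * 2^-1 ^+ n =
        k * (2 * `|y| * 2^-1 ^+ n) * (2 * `|z|) by rewrite /K; ring.
      rewrite (le_trans (lk _ _))//; apply: ler_pM => //.
        by rewrite mulr_ge0// ltW.
      by rewrite ler_wpM2l// ltW.
    have -> : K *+ 2 * 2^-1 ^+ n =
      k * (2 * `|y|) * (2 * `|z| * 2^-1 ^+ n) by rewrite /K; ring.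
    rewrite (le_trans (lk _ _))//; apply: ler_pM => //.
      by rewrite mulr_ge0// ltW.
    by rewrite ler_wpM2l// ltW.
exists f; split=> //.
- apply: (near_id_dense_range fH) => y.
  have := fS y 1%N; rewrite S1 => /le_trans; apply.
  rewrite expr1 mulrAC ler_wpM2r//.
  rewrite -ler_pdivlMl// (le_trans c4)//.
  by rewrite -invfM -natrM.
- move=> y; have := fS y 2.
  by rewrite /S big_ord_recl big_ord_recl big_ord0 addr0 /t /= invr1 scale1r.
Qed.

End Exponential.

(* The automorphisms exp(sE), for a rescaling E of D and s = 2^-m, leave the
   closed subspace [P A] invariant; so does their derivative at s = 0. *)
Lemma derivation_invariant (R : realType) (P : lie_map R) (A : banachLieType R)
    (D : A -> A) (k : R[i]) : preradical P -> linear D ->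
  (forall y z, D (lie y z) = lie (D y) z + lie y (D z)) ->
  (forall y, `|D y| <= k * `|y|) -> forall x, P A x -> P A (D x).
Proof.
move=> hP Dl Dder Dk x Px; have [P0 Pl _ Pc] := proj1 hP A.
have PZ a y : P A y -> P A (a *: y).
  by move=> Py; rewrite -[_ *: _]addr0; apply: Pl.
(* Dividing [D] by [K] brings its bound below [4^-1], as the exponential requires. *)
pose K : R[i] := 4 * (`|k| + 1).
have K0 : 0 < K by rewrite mulr_gt0// ltr_wpDl.
have DK y : `|K^-1 *: D y| <= 4^-1 * `|y|.
  rewrite normrZ gtr0_norm ?invr_gt0// -ler_pdivlMl ?invr_gt0// invrK mulrA.
  rewrite /K [4 * _]mulrC mulfK ?pnatr_eq0//.
  have ky : 0 <= k * `|y| by rewrite (le_trans _ (Dk y)).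
  rewrite (le_trans (Dk y))// -(ger0_norm ky) normrM normr_id.
  by rewrite ler_wpM2r// lerDl.
suff : P A (K^-1 *: D x).
  by move=> /(PZ K); rewrite scalerA divff ?gt_eqF// scale1r.
apply: Pc; apply/closure_normP => e e0.
have x1 : 0 < `|x| + 1 by rewrite ltr_wpDl.
have [|m me] := @small_expn R (e / (`|x| + 1)); first by rewrite divr_gt0.
pose s : R[i] := 2^-1 ^+ m.
have s0 : 0 < s by rewrite exprn_gt0// invr_gt0.
have s1 : s <= 1 by rewrite exprn_ile1 ?invr_ge0// invf_le1// ler1n.
pose E y := s *: (K^-1 *: D y).
have [] := @exponential_ex R A E (s * 4^-1).
- by rewrite mulr_ge0 ?invr_ge0// ltW.
- by rewrite ler_piMl ?invr_ge0.
- move=> a y z; rewrite /E Dl !scalerDr !scalerA; congr (_ *: _ + _).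
  ring.
- move=> y z; rewrite /E Dder !scalerDr.
  by rewrite !lieZl !lieZr.
- by move=> y; rewrite normrZ gtr0_norm// -mulrA ler_wpM2l// ltW.
move=> f [fH fD fE].
(* The difference quotient at time [s]; by the quadratic estimate it lies within [s * |x|] of
   [K^-1 *: D x], and [m] was chosen to make this less than [e]. *)
exists (s^-1 *: (f x - x)).
  apply: PZ; rewrite addrC -scaleN1r; apply: Pl => //.
  exact: (preradical_hom hP fH fD).
have -> : K^-1 *: D x - s^-1 *: (f x - x) = - (s^-1 *: (f x - (x + E x))).
  rewrite opprD addrA [in RHS]scalerBr opprB; congr (_ - _).
  by rewrite /E scalerA mulVf ?scale1r// gt_eqF.
rewrite normrN normrZ gtr0_norm ?invr_gt0//.
have le1 : s^-1 * `|f x - (x + E x)| <= s * `|x|.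
  rewrite -ler_pdivlMl ?invr_gt0// invrK (le_trans (fE x))//.
  have -> : 2 * `|x| * (s * 4^-1) ^+ 2 = s * (s * `|x|) * (2 * 4^-1 ^+ 2).
    by ring.
  rewrite ler_piMr ?mulr_ge0 ?(ltW s0)// exprVn ler_pdivrMr ?exprn_gt0// mul1r.
  by rewrite -natrX ler_nat.
apply: le_lt_trans le1 _; move: me; rewrite ltr_pdivlMr//; apply: le_lt_trans.
by rewrite ler_wpM2l ?(ltW s0)// lerDl.
Qed.

Arguments star_map {R} P L _.
Arguments circ_map {R} P L _.

(** * The successor steps of the two chains, and their stable values *)

Section SubQuotMaps.
Context {R : realType}.
Implicit Types (P : lie_map R) (L : banachLieType R).

(** Proof irrelevance removes the existential over closedness proofs. *)
Lemma sub_mapE P L (S : set L) (hS : closed_subalgebra S) :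
  sub_map P S = sub_val (hS := hS) @` P (subLie hS).
Proof.
apply/seteqP; split=> x.
  by move=> [hS' [y [Py <-]]]; rewrite (Prop_irrelevance hS hS'); exists y.
by move=> [y Py <-]; exists hS, y.
Qed.

Lemma quot_mapE P L (I : set L) (hI : closed_ideal I) :
  quot_map P I = quot_proj hI @^-1` P (quotLie hI).
Proof.
apply/seteqP; split=> x; last by exists hI.
by move=> [hI']; rewrite (Prop_irrelevance hI hI').
Qed.

Lemma sub_map_sub P L (S : set L) : sub_map P S `<=` S.
Proof. by move=> _ [hS [y [_ <-]]]; exact: subLieP. Qed.

Lemma sub_map_setT P L (S : set L) (hS : closed_subalgebra S) :
  sub_map P S = S <-> P (subLie hS) = setT.
Proof.
rewrite (sub_mapE _ hS); split=> [E|->].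
  apply/seteqP; split=> // x _; have : S (sub_val x) by exact: sub_valP.
  by rewrite -{1}E => -[y Py /sub_val_inj <-].
apply/seteqP; split=> [_ [x _ <-]|x Sx]; first exact: sub_valP.
by have [y <-] := sub_val_ex hS Sx; exists y.
Qed.

Lemma sub_map_closed_ideal P L (I : set L) : preradical P ->
  closed_ideal I -> closed_ideal (sub_map P I).
Proof.
move=> hP hI; have hS := closed_idealW hI; have [_ _ Ia Ic] := hI.
have [P0 Pl _ Pc] := proj1 hP (subLie hS); have vH := lie_hom_val hS.
rewrite (sub_mapE _ hS); split.
- by exists 0 => //; exact: hom0.
- move=> c _ _ [x Px <-] [y Py <-]; exists (c *: x + y); first exact: Pl.
  exact: (homP vH).
- move=> x _ [y Py <-].
  have /choice[D DE] (z : subLie hS) :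
      exists w : subLie hS, sub_val w = lie x (sub_val z).
    by apply: sub_val_ex; apply: Ia; exact: sub_valP.
  rewrite -DE; exists (D y) => //.
  (* [D] is the restriction of ad x, a derivation of I. *)
  have [t t0 lt] := @lie_bounded R L.
  apply: (@derivation_invariant _ _ _ D (t * `|x|)) => //.
  + move=> c u v; apply: (@sub_val_inj _ _ _ hS).
    by rewrite (homP vH) !DE (homP vH) lieDr lieZr.
  + move=> u v; apply: (@sub_val_inj _ _ _ hS).
    rewrite (homD vH) !(homL vH) !DE (homL vH).
    have /eqP := lie_jacobi x (sub_val u) (sub_val v).
    rewrite -addrA addr_eq0 => /eqP ->.
    rewrite opprD addrC -lieC; congr (_ + _).
    by rewrite (lieC x) -[in RHS]scaleN1r lieZr scaleN1r.
  + by move=> u; have := lt x (sub_val u); rewrite -DE.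
- move=> x xcl.
  have /sub_val_ex[y yx] : I x.
    by apply: Ic; apply: closureS xcl => _ [z _ <-]; exact: sub_valP.
  exists y => //; apply: Pc; apply: sub_closure; rewrite yx; exact: xcl.
Qed.

Lemma quot_map_closed_ideal P L (I : set L) : preradical P ->
  closed_ideal I -> closed_ideal (quot_map P I).
Proof.
move=> hP hI; rewrite (quot_mapE P hI).
exact: (preimage_closed_ideal (lie_hom_proj hI) (proj1 hP _)).
Qed.

Lemma quot_map_id P L (I : set L) (hI : closed_ideal I) :
  quot_map P I `<=` I <-> P (quotLie hI) `<=` [set 0].
Proof.
rewrite (quot_mapE P hI); split=> [PI q|P0 x /P0 /=].
  by have [x <-] := quot_proj_surj q => Px; apply: quot_proj_eq0W; exact: PI.
by move/quot_proj_eq0.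
Qed.

Lemma sub_map_mono P L (I J : set L) : preradical P -> balanced P ->
  closed_ideal I -> closed_ideal J -> I `<=` J -> sub_map P I `<=` sub_map P J.
Proof.
move=> hP bP hI hJ IJ; have sJ := closed_idealW hJ.
have [i [iH iI iE]] := ideal_inclusion hI sJ IJ.
rewrite (sub_mapE P (closed_idealW hI)) (sub_mapE P sJ) => _ [x Px <-].
by rewrite -iE; exists (i x) => //; exact: (balanced_hom hP bP iH iI).
Qed.

(** The surjection from L/I to L/J carries R(L/I) into R(L/J), which is zero. *)
Lemma quot_map_le P L (I J : set L) : preradical P ->
  closed_ideal I -> closed_ideal J -> quot_map P J `<=` J ->
  I `<=` J -> quot_map P I `<=` J.
Proof.
move=> hP hI hJ /(quot_map_id P hJ) PJ IJ.
have [|h hH hE] := hom_factor (lie_hom_proj hI) (@norm_lifting_proj _ _ _ hI)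
    (lie_hom_proj hJ).
  by move=> x /quot_proj_eq0 /IJ; exact: quot_proj_eq0W.
rewrite (quot_mapE P hI) => x Px; apply/(quot_proj_eq0 hJ); apply: PJ.
rewrite -hE; apply: (preradical_hom hP hH) Px; apply: surj_dense_range => q.
by have [y <-] := quot_proj_surj q; exists (quot_proj hI y).
Qed.

Lemma closed_ideal0 L : closed_ideal [set 0 : L].
Proof.
split=> // [c x y -> ->|x y ->|].
- by rewrite scaler0 addr0.
- exact: lie0r.
- move=> x /closure_normP x0; apply/eqP; apply: contrapT => /negP nx.
  have [|_ ->] := x0 `|x|; first by rewrite normr_gt0.
  by rewrite subr0 ltxx.
Qed.

Lemma closed_idealT L : closed_ideal [set: L].
Proof. by split. Qed.

Lemma closed_ideal_bigcap L (F : set (set L)) :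
  F `<=` (@closed_ideal R L) -> closed_ideal (\bigcap_(A in F) A).
Proof.
move=> FI; split.
- by move=> A /FI[].
- move=> c x y Fx Fy A FA; have [_ Al _ _] := FI A FA.
  by apply: Al; [exact: Fx|exact: Fy].
- by move=> x y Fy A FA; have [_ _ Aa _] := FI A FA; apply: Aa; exact: Fy.
- move=> x xcl A FA; have [_ _ _ Ac] := FI A FA; apply: Ac.
  by apply: closureS xcl => y; exact.
Qed.

Lemma closed_ideal_bigcup L (F : set (set L)) : F !=set0 ->
  F `<=` (@closed_ideal R L) ->
  (forall A B, F A -> F B -> A `<=` B \/ B `<=` A) ->
  closed_ideal (closure (\bigcup_(A in F) A)).
Proof.
move=> [A0 FA0] FI Fchain; apply: closed_ideal_closure.
- by exists A0 => //; have [] := FI _ FA0.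
- move=> c x y [A FA Ax] [B FB By].
  have [AB|BA] := Fchain _ _ FA FB.
    by exists B => //; have [_ Bl _ _] := FI _ FB; apply: Bl => //; exact: AB.
  by exists A => //; have [_ Al _ _] := FI _ FA; apply: Al => //; exact: BA.
- move=> x y [A FA Ay]; apply: subset_closure; exists A => //.
  by have [_ _ Aa _] := FI _ FA; exact: Aa.
Qed.

(** The stable value exists and is unique, so [xget] returns it and never its default. *)
Lemma star_map_spec P L : preradical P ->
  [/\ closed_ideal (star_map P L),
      quot_map P (star_map P L) = star_map P L &
      forall J, closed_ideal J -> quot_map P J `<=` J -> star_map P L `<=` J].
Proof.
move=> hP; have [] := @stable_value_ex (set L) [set 0] (@quot_map R P L)
  (fun F => closure (\bigcup_(A in F) A)) (@closed_ideal R L)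
  (fun A B => A `<=` B).
- by move=> A; exact: subset_refl.
- by move=> B A C; exact: subset_trans.
- by move=> A B AB BA; apply/seteqP.
- exact: closed_ideal0.
- by move=> J [J0 _ _ _] _ ->.
- by move=> I; exact: quot_map_closed_ideal.
- move=> I hI x Ix; rewrite (quot_mapE P hI) /= quot_proj_eq0W//.
  by have [] := proj1 hP (quotLie hI).
- by move=> I J hI hJ PJ IJ; exact: quot_map_le.
- exact: closed_ideal_bigcup.
- move=> F A _ FA; apply: subset_trans (@subset_closure _ _).
  exact: bigcup_sup.
- move=> F J _ [_ _ _ Jc] FJ x xcl; apply: Jc.
  by apply: closureS xcl; exact: bigcup_sub.
move=> e [eI eS eL est euniq]; suff -> : star_map P L = e by [].
by apply: euniq; exact: (xgetPex set0 (ex_intro _ e est)).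
Qed.

(** The dual argument, for reverse inclusion; balance supplies the monotonicity of [sub_map]. *)
Lemma circ_map_spec P L : preradical P -> balanced P ->
  [/\ closed_ideal (circ_map P L),
      sub_map P (circ_map P L) = circ_map P L &
      forall J, closed_ideal J -> J `<=` sub_map P J -> J `<=` circ_map P L].
Proof.
move=> hP bP; have [] := @stable_value_ex (set L) setT (@sub_map R P L)
  (fun F => \bigcap_(A in F) A) (@closed_ideal R L) (fun A B => B `<=` A).
- by move=> A; exact: subset_refl.
- by move=> B A C AB BC; exact: subset_trans AB.
- by move=> A B AB BA; apply/seteqP.
- exact: closed_idealT.
- by move=> J _ x _.
- by move=> I; exact: sub_map_closed_ideal.
- by move=> I _; exact: sub_map_sub.
- by move=> I J hI hJ JP JI; apply: subset_trans JP _; exact: sub_map_mono.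
- by move=> F _ FI _; exact: closed_ideal_bigcap.
- by move=> F A _ FA; exact: bigcap_inf.
- by move=> F J _ _ FJ; exact: sub_bigcap.
move=> e [eI eS eL est euniq]; suff -> : circ_map P L = e by [].
by apply: euniq; exact: (xgetPex set0 (ex_intro _ e est)).
Qed.

End SubQuotMaps.

(** * The smallest radical above an under radical *)

Section Star.
Context {R : realType}.
Variable P : lie_map R.
Hypothesis uP : under_radical P.
Implicit Types L M A B : banachLieType R.
Local Notation star := (star_map P).
Local Arguments P : clear implicits.

Let hP : preradical P. Proof. by have [] := uP. Qed.
Let lP : lower_stable P. Proof. by have [] := uP. Qed.
Let bP : balanced P. Proof. by have [] := uP. Qed.

Let starI L : closed_ideal (star L).
Proof. by have [] := star_map_spec L hP. Qed.

Let star_least L (J : set L) (hJ : closed_ideal J) :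
  (forall q, P (quotLie hJ) q -> q = 0) -> star L `<=` J.
Proof.
move=> PJ; have [_ _] := star_map_spec L hP; apply=> //.
by apply/(quot_map_id P hJ).
Qed.

Let quot_star L (hI : closed_ideal (star L)) q : P (quotLie hI) q -> q = 0.
Proof.
have [_ E _] := star_map_spec L hP; move: q.
by apply/(quot_map_id P hI); rewrite E.
Qed.

(** With J the kernel of [f], the induced injection of A/J into [B] sends R(A/J) into R(B) = 0; so
    R(A/J) = 0 and leastness puts [star A] inside J. The next three properties follow by choosing
    [f] with target a quotient by [star]. *)
Let star_vanish A B (f : A -> B) : lie_hom f -> ideal_range f ->
  (forall y, P B y -> y = 0) -> forall x, star A x -> f x = 0.
Proof.
move=> fH fI PB; have hJ := preimage_closed_ideal fH (closed_ideal0 B).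
have [|h hH hE] := hom_factor (lie_hom_proj hJ)
    (@norm_lifting_proj _ _ _ hJ) fH.
  by move=> x /quot_proj_eq0.
suff PJ q : P (quotLie hJ) q -> q = 0 by exact: (star_least PJ).
have hI := ideal_range_factor (@quot_proj_surj _ _ _ hJ) hE fI.
move=> /(balanced_hom hP bP hH hI) /PB; have [x <-] := quot_proj_surj q.
by rewrite hE => fx; exact: quot_proj_eq0W.
Qed.

Let star_preradical : preradical star.
Proof.
split=> // L M f /morphism_lie_hom[fH fD] _ [x Lx <-].
have hM := starI M; apply/(quot_proj_eq0 hM).
apply: (@star_vanish _ _ (quot_proj hM \o f)) => //.
- exact: lie_hom_comp fH (lie_hom_proj hM).
- apply: dense_ideal_range; apply: dense_range_comp fD _.
    exact: lie_hom_proj.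
  exact: surj_dense_range (quot_proj_surj (hI := hM)).
- exact: quot_star.
Qed.

Let star_upper : upper_stable star.
Proof.
move=> L hI; apply/seteqP; split=> [q|_ ->]; last first.
  by have [] := starI (quotLie hI).
apply: (@star_vanish _ _ id).
- exact: lie_hom_id.
- by apply: dense_ideal_range; apply: surj_dense_range => y; exists y.
- exact: quot_star.
Qed.

Let star_balanced : balanced star.
Proof.
move=> L I hI; rewrite (sub_mapE _ (closed_idealW hI)) => _ [x Ix <-].
have hL := starI L; apply/(quot_proj_eq0 hL).
apply: (@star_vanish _ _
  (quot_proj hL \o sub_val (hS := closed_idealW hI))) => //.
- exact: lie_hom_comp (lie_hom_val _) (lie_hom_proj _).
- apply: ideal_range_comp_surj; first exact: lie_hom_proj.
    by apply: ideal_range_val; have [] := hI.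
  exact: quot_proj_surj.
- exact: quot_star.
Qed.

(* With I = R*(L) and J = R*(I), the algebra K = R(L/J) lies in I/J and
   satisfies R(K) = K, whereas R(I/J) = 0; hence K = 0 and I is contained in
   J. *)
Let star_lower : lower_stable star.
Proof.
move=> L; apply/seteqP; split; first exact: sub_map_sub.
have hI := starI L; have hJ := sub_map_closed_ideal star_preradical hI.
set J := sub_map _ _ in hJ *; have [_ _] := star_map_spec L hP; apply=> //.
have hK : closed_ideal (P (quotLie hJ)) := proj1 hP _.
have sK := closed_idealW hK.
have hK' := preimage_closed_ideal (lie_hom_proj hJ) hK.
have K'I : quot_proj hJ @^-1` P (quotLie hJ) `<=` star L.
  rewrite -quot_mapE; have [_ E _] := star_map_spec L hP.
  by apply: quot_map_le => //; [rewrite E|exact: sub_map_sub].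
have [f [fH fl fE]] := sub_quot_lifting sK (closed_idealW hK').
have [i [iH iI iE]] := ideal_inclusion hK' (closed_idealW hI) K'I.
(* I/J is realized as the quotient of the algebra I by [N], the copy of J inside it. *)
pose N := star (subLie (closed_idealW hI)).
have hN : closed_ideal N by exact: starI.
have JN x : J (sub_val x) <-> N x.
  rewrite /J (sub_mapE _ (closed_idealW hI)); split; last by exists x.
  by move=> [y Ny /sub_val_inj <-].
have gH := lie_hom_comp iH (lie_hom_proj hN).
have gI := ideal_range_comp_surj (lie_hom_proj hN) iI
  (quot_proj_surj (hI := hN)).
have [|h hH hE] := hom_factor fH fl gH.
  move=> x fx; apply: quot_proj_eq0W; apply/JN; rewrite iE.
  by apply/(quot_proj_eq0 hJ); rewrite -fE fx.
have hR := ideal_range_factor (fun y => norm_lifting_surj y fl) hE gI.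
have PK : P (subLie sK) = setT by apply/sub_map_setT; exact: lP.
rewrite (quot_mapE P hJ) => x Kx.
have [x' xE] := sub_val_ex (closed_idealW hK') Kx.
rewrite -xE -iE; apply/JN/(quot_proj_eq0 hN).
have <- : h (f x') = quot_proj hN (i x') by exact: hE.
by apply: quot_star; apply: (balanced_hom hP bP hH hR); rewrite PK.
Qed.

(** R(L) maps into R(L/[star L]) = 0. For a radical S above R, R(L/S(L)) lies in S(L/S(L)) = 0, so
    leastness applies to S(L). *)
Lemma star_smallest : smallest_radical_above P (star_map P).
Proof.
split; first by split.
- move=> L x Px; have hI := starI L; apply/(quot_proj_eq0 hI).
  apply: quot_star; apply: (preradical_hom hP (lie_hom_proj hI)) Px.
  exact: surj_dense_range (quot_proj_surj (hI := hI)).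
- move=> S [hS _ uS _] PS L; have hI := proj1 hS L.
  by apply: (star_least (hJ := hI)) => q /PS; rewrite uS.
Qed.

End Star.

(** * The largest radical below an over radical *)

Section Circ.
Context {R : realType}.
Variable P : lie_map R.
Hypothesis oP : over_radical P.
Implicit Types L M A B : banachLieType R.
Local Notation circ := (circ_map P).
Local Arguments P : clear implicits.

Let hP : preradical P. Proof. by have [] := oP. Qed.
Let uP : upper_stable P. Proof. by have [] := oP. Qed.
Let bP : balanced P. Proof. by have [] := oP. Qed.

Let circI L : closed_ideal (circ L).
Proof. by have [] := circ_map_spec L hP bP. Qed.

Let circ_full L (hS : closed_subalgebra (circ L)) : P (subLie hS) = setT.
Proof. by apply/sub_map_setT; have [] := circ_map_spec L hP bP. Qed.

(** Let C be the closure of the range. R(C) is closed and contains the dense image of R(A) = A, so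
    R(C) = C and C lies in [circ L] by maximality. *)
Let circ_greatest A L (f : A -> L) : lie_hom f -> ideal_range f ->
  P A = setT -> forall x, circ L (f x).
Proof.
move=> fH fI PA x; have IC := closed_ideal_range fH fI.
have fC y : closure (range f) (f y) by apply: subset_closure; exists y.
have [g gH gf] := corestriction (closed_idealW IC) fH fC.
have gD : dense_range g.
  move=> y; apply: sub_closure; apply: closureS (sub_valP y) => _ [z _ <-].
  by exists (g z); [exists z|].
have [_ _ cL] := circ_map_spec L hP bP; apply: (cL _ IC _ _ (fC x)).
have -> : sub_map P (closure (range f)) = closure (range f); last by [].
apply/(sub_map_setT P (closed_idealW IC)); apply/seteqP; split=> // y _.
have [_ _ _ Pc] := proj1 hP (subLie (closed_idealW IC)).
apply: Pc; apply: closureS (gD y) => _ [z _ <-].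
by apply: (preradical_hom hP gH gD); rewrite PA.
Qed.

Let circ_preradical : preradical circ.
Proof.
split=> // L M f /morphism_lie_hom[fH fD] _ [x Lx <-].
have sI := closed_idealW (circI L); have [x' <-] := sub_val_ex sI Lx.
apply: (@circ_greatest _ _ (f \o sub_val (hS := sI))); last exact: circ_full.
  exact: lie_hom_comp (lie_hom_val _) fH.
(* An element [y] of M is only a limit of values [f u]; for these the bracket is the image of
   [lie u z], which stays in the ideal [circ L]. *)
move=> y z /=; have [k k0 zk] := adB_le (f (sub_val z)).
have zk' u v : `|lie u (f (sub_val z)) - lie v (f (sub_val z))| <= k * `|u - v|.
  by rewrite lieC (lieC v) opprK addrC distrC.
apply: closureS (Lipschitz_closure k0 zk' (fD y)) => _ [_ [u _ <-] <-].
have [_ _ Ia _] := circI L.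
have /(sub_val_ex sI)[w wE] : circ L (lie u (sub_val z)).
  by apply: Ia; exact: sub_valP.
by exists w => //=; rewrite wE (homL fH).
Qed.

Let circ_lower : lower_stable circ.
Proof.
move=> L; apply/(sub_map_setT _ (closed_idealW (circI L))).
apply/seteqP; split=> // x _; apply: (@circ_greatest _ _ id).
- exact: lie_hom_id.
- by apply: dense_ideal_range; apply: surj_dense_range => y; exists y.
- exact: circ_full.
Qed.

(** Since [circ] is already a preradical, [sub_map_closed_ideal] applies to it and makes [circ] of I
    an ideal of the whole of [L]. *)
Let circ_balanced : balanced circ.
Proof.
move=> L I hI x Ix; have hJ := sub_map_closed_ideal circ_preradical hI.
move: Ix; rewrite (sub_mapE _ (closed_idealW hI)) => -[y Iy <-].
have sC := closed_idealW (circI (subLie (closed_idealW hI))).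
have [z <-] := sub_val_ex sC Iy.
have vH := lie_hom_val (closed_idealW hI).
apply: (@circ_greatest _ _
  (sub_val (hS := closed_idealW hI) \o sub_val (hS := sC))).
- exact: lie_hom_comp (lie_hom_val _) vH.
- move=> u v /=; apply: subset_closure; have [_ _ Ja _] := hJ.
  have : sub_map circ I (lie u (sub_val (sub_val v))).
    apply: Ja; rewrite (sub_mapE _ (closed_idealW hI)).
    by exists (sub_val v) => //; exact: sub_valP.
  rewrite (sub_mapE _ (closed_idealW hI)) => -[w Cw <-].
  by have [w' <-] := sub_val_ex sC Cw; exists w'.
- exact: circ_full.
Qed.

(* K denotes R°(L/I) with I = R°(L), and K' its preimage in L.  The quotient
   K'/R(K') is an image of K since R(K') contains R(I) = I; as R(K) = K, it
   equals its own R, which is 0. *)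
Let circ_upper : upper_stable circ.
Proof.
move=> L hI; apply/seteqP; split=> [q Kq|_ ->]; last first.
  by have [] := circI (quotLie hI).
have hK := circI (quotLie hI); have sK := closed_idealW hK.
have hK' := preimage_closed_ideal (lie_hom_proj hI) hK.
have sK' := closed_idealW hK'.
have [f [fH fl fE]] := sub_quot_lifting sK sK'.
have IK' : circ L `<=` quot_proj hI @^-1` circ (quotLie hI).
  by move=> x Ix; rewrite /= quot_proj_eq0W//; have [] := hK.
have [i [iH iI iE]] := ideal_inclusion hI sK' IK'.
pose N := P (subLie sK'); have hN : closed_ideal N := proj1 hP _.
have [|h hH hE] := hom_factor fH fl (lie_hom_proj hN).
  move=> x fx; apply: quot_proj_eq0W.
  have /(sub_val_ex (closed_idealW hI))[y yx] : circ L (sub_val x).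
    by apply/(quot_proj_eq0 hI); rewrite -fE fx.
  have <- : i y = x by apply: sub_val_inj; rewrite iE.
  by apply: (balanced_hom hP bP iH iI); rewrite circ_full.
have hD : dense_range h.
  apply: surj_dense_range => y; have [x <-] := quot_proj_surj y.
  by exists (f x).
have NT : N = setT.
  apply/seteqP; split=> // x _; apply/(quot_proj_eq0 hN); rewrite -hE.
  have : P _ (h (f x)) by apply: (preradical_hom hP hH hD); rewrite circ_full.
  by rewrite uP.
(* Now R(K') = K', so K' lies in [circ L] by maximality and its image K is zero. *)
have [x xq] := quot_proj_surj q; rewrite -xq in Kq *.
apply: quot_proj_eq0W; have [x' <-] := sub_val_ex sK' Kq.
apply: (circ_greatest (lie_hom_val sK')) => //.
by apply: ideal_range_val; have [] := hK'.
Qed.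

(** Balance carries R([circ L]) = [circ L] into R(L). For a radical S below R, lower stability gives
    S(S(L)) = S(L), hence R(S(L)) = S(L), and maximality applies. *)
Lemma circ_largest : largest_radical_below P (circ_map P).
Proof.
split; first by split.
- move=> L x Cx; have sI := closed_idealW (circI L).
  have [y <-] := sub_val_ex sI Cx.
  apply: (balanced_hom hP bP (lie_hom_val sI)); last by rewrite circ_full.
  by apply: ideal_range_val; have [] := circI L.
- move=> S [hS lS _ _] SP L x Sx; have hI := proj1 hS L.
  have sI := closed_idealW hI; have [y <-] := sub_val_ex sI Sx.
  apply: (circ_greatest (lie_hom_val sI)).
    by apply: ideal_range_val; have [] := hI.
  apply/seteqP; split=> // z _; apply: SP.
  by have /(sub_map_setT S sI) -> := lS L.
Qed.

End Circ.

Theorem theorem4p6 (R : realType) (P : lie_map R) (hP : preradical P) :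
  (under_radical P -> smallest_radical_above P (star_map P)) /\
  (over_radical P -> largest_radical_below P (circ_map P)).
Proof. by split=> [/star_smallest|/circ_largest]. Qed.
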